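(* For every integer $n\geq 12$, $\mathrm{ex}_{\mathcal{P}}(n,S_{2,4})\leq \frac{17}{7}n-2$.
   Context: All graphs are finite and simple. For a graph $F$, the planar Turán number $\mathrm{ex}_{\mathcal{P}}(n,F)$ is the maximum number of edges in an $n$-vertex planar graph that contains no subgraph isomorphic to $F$. For positive integers $m,k$, the double star $S_{m,k}$ is the tree obtained from an edge $xy$ (the backbone) by joining $x$ to $m$ new vertices and $y$ to $k$ further new vertices, all these $m+k$ vertices distinct. *)

(* Defs.v *)
From Stdlib Require Import Reals.
From mathcomp Require Import all_boot.

Set Implicit Arguments.
Unset Strict Implicit.
Unset Printing Implicit Defensive.

Definition simple_graph (T : finType) (e : rel T) : Prop :=
  symmetric e /\ irreflexive e.

Definition nedges (n : nat) (e : rel 'I_n) : nat :=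
  #|[set p : 'I_n * 'I_n | e p.1 p.2 && (p.1 < p.2)%N]|.

Definition contains_subgraph (TG : finType) (eG : rel TG)
  (TF : finType) (eF : rel TF) : Prop :=
  exists f : TF -> TG, injective f /\ forall u v, eF u v -> eG (f u) (f v).

(* Double star S_{m,k} on 'I_(m+k+2): 0 = x, 1 = y (backbone xy),
   2 .. m+1 are the m leaves of x, m+2 .. m+k+1 are the k leaves of y. *)
Definition dstar_half (m k : nat) (i j : 'I_(m + k + 2)) : bool :=
  [|| ((val i == 0) && (val j == 1)),
      ((val i == 0) && (2 <= val j)%N && (val j < m + 2)%N)
    | ((val i == 1) && (m + 2 <= val j)%N && (val j < m + k + 2)%N)].

Arguments dstar_half : clear implicits.
Definition double_star (m k : nat) : rel 'I_(m + k + 2) :=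
  fun i j => dstar_half m k i j || dstar_half m k j i.

(* Planarity, topologically: vertices are distinct points of R^2 and every
   edge xy is realized by an arc (continuous injective image of [0,1]) from
   x to y, whose interior contains no vertex, and interiors of arcs of
   distinct edges are disjoint.  An arc is given for every ordered pair
   (x,y) with e x y; continuity is required on all of R (any path on [0,1]
   extends continuously by constants, so this is no restriction). *)
Local Open Scope R_scope.
Definition planar (T : finType) (e : rel T) : Prop :=
  exists (pos : T -> (R * R)%type) (arc : T -> T -> R -> (R * R)%type),
    injective pos /\
    (forall x y, e x y ->
       continuity (fun t => fst (arc x y t)) /\
       continuity (fun t => snd (arc x y t)) /\
       arc x y 0 = pos x /\ arc x y 1 = pos y /\
       (forall s t, (0 <= s <= 1) -> (0 <= t <= 1) ->
          arc x y s = arc x y t -> s = t) /\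
       (forall z s, (0 < s < 1) -> arc x y s <> pos z)) /\
    (forall x y u v, e x y -> e u v ->
       ~ ((x = u /\ y = v) \/ (x = v /\ y = u)) ->
       forall s t, (0 < s < 1) -> (0 < t < 1) ->
         arc x y s <> arc u v t).
Arguments double_star : clear implicits.

(* Main.v *)
Require Import Defs.
From Stdlib Require Import Reals Lra Ring ClassicalEpsilon.
From mathcomp Require Import all_boot zify.

(* Planarity enters through van Kampen's parity obstruction.  Approximating the
   arcs of a drawing by polygonal lines, let [x a b c] be the parity of the number
   of times the edge [ab] passes above the vertex [c].  For two disjoint edges [ab]
   and [cd] the drawing does not cross, and this forces
   [x a b c + x a b d + x c d a + x c d b] to be the parity with which the endpoints
   interleave from left to right.  Summing these equations over the pairs of disjoint
   edges of K_5, of K_{3,3}, or of K_{3,3} with a subdivided edge gives a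
   contradiction.

   The bound follows from the stronger statement that the average degree is at most
   9/2, by discharging: a vertex of degree [d] has charge [12 d - 54].  In an
   S_{2,4}-free graph a vertex of degree at least 7 has only neighbours of degree at
   most 2, a neighbour of degree at least 3 of a vertex [y] of degree 6 has all its
   neighbours in [N[y]], and a neighbour of a vertex [y] of degree 5 has at most one
   neighbour outside [N[y]].  If no neighbour of a degree-6 vertex has degree at most
   2, its closed neighbourhood is a component with at most 15 edges.  Elsewhere the
   positive charges can be moved to neighbours of degree at most 4; the critical case
   is a vertex of degree 5 all of whose neighbours have degree 4 or 5, where planarity
   leaves at least three neighbours of degree 4, or a fan with two of them. *)

Set Implicit Arguments.
Unset Strict Implicit.
Unset Printing Implicit Defensive.

(** * Parities as the two-element ring, in which [ring] cancels equal terms in pairs *)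

Lemma addb_ring_theory : ring_theory false true addb andb addb id eq.
Proof. by split=> //; do !case. Qed.

Lemma eqb_eq (a b : bool) : eqb a b = true -> a = b.
Proof. by case: a; case: b. Qed.

Add Ring addb_ring : addb_ring_theory (decidable eqb_eq).

Lemma eq_addb (a b : bool) : a = b <-> a (+) b = false.
Proof. by case: a; case: b. Qed.

(** * Disjoint segments and polygonal lines *)

Section Plane.
Local Open Scope R_scope.

Definition ltR (x y : R) : bool := if Rlt_dec x y then true else false.

Lemma ltRP (x y : R) : reflect (x < y) (ltR x y).
Proof. by rewrite /ltR; case: Rlt_dec => h; constructor. Qed.

(** Breaking ties by ordinate acts as an infinitesimal shear of the plane, so no general position
    has to be assumed. *)
Definition ltlex (p q : R * R) : bool :=
  ltR p.1 q.1 || (~~ ltR q.1 p.1 && ltR p.2 q.2).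

Lemma ltlexP (p q : R * R) :
  reflect (p.1 < q.1 \/ p.1 = q.1 /\ p.2 < q.2) (ltlex p q).
Proof.
rewrite /ltlex; case: ltRP => h1 /=; first by constructor; left.
case: ltRP => h2 /=; first by constructor; lra.
by case: ltRP => h3; constructor; lra.
Qed.

Lemma ltlex_total (p q : R * R) : p <> q -> ltlex q p = ~~ ltlex p q.
Proof.
case: p q => [p1 p2] [q1 q2] npq.
have : p1 <> q1 \/ p2 <> q2.
  case: (Req_dec p1 q1) => [e1|]; last by left.
  by right=> e2; apply: npq; rewrite e1 e2.
by case: ltlexP => /= h1; case: ltlexP => /= h2 // h3; lra.
Qed.

Definition point_at (p q : R * R) (a : R) : R * R :=
  (p.1 + a * (q.1 - p.1), p.2 + a * (q.2 - p.2)).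

Definition seg_disjoint (p0 p1 q0 q1 : R * R) : Prop :=
  forall a b, 0 <= a <= 1 -> 0 <= b <= 1 -> point_at p0 p1 a <> point_at q0 q1 b.

Definition line_at (p q : R * R) (x : R) : R :=
  p.2 + (q.2 - p.2) / (q.1 - p.1) * (x - p.1).

(* Whether the upward vertical ray issued from [r] crosses the segment [pq],
   ties between abscissae being broken by the lexicographic order. *)
Definition above (p q r : R * R) : bool :=
  (ltlex r p (+) ltlex r q) && ltR r.2 (line_at p q r.1).

Lemma line_atC (p q : R * R) (x : R) : p.1 <> q.1 -> line_at p q x = line_at q p x.
Proof. by move=> h; rewrite /line_at; field; lra. Qed.

Lemma point_atC (p q : R * R) (a : R) : point_at p q a = point_at q p (1 - a).
Proof. by rewrite /point_at; congr pair; ring. Qed.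

Lemma seg_disjointCl (p0 p1 q0 q1 : R * R) :
  seg_disjoint p0 p1 q0 q1 -> seg_disjoint p1 p0 q0 q1.
Proof. by move=> h a b ha hb; rewrite point_atC; apply: h; lra. Qed.

Lemma seg_disjointC (p0 p1 q0 q1 : R * R) :
  seg_disjoint p0 p1 q0 q1 -> seg_disjoint q0 q1 p0 p1.
Proof. by move=> h a b ha hb /esym; apply: h. Qed.

Lemma seg_disjointCr (p0 p1 q0 q1 : R * R) :
  seg_disjoint p0 p1 q0 q1 -> seg_disjoint p0 p1 q1 q0.
Proof. by move=> h; apply/seg_disjointC/seg_disjointCl/seg_disjointC. Qed.

Lemma seg_disjoint_end (p0 p1 q0 q1 : R * R) : seg_disjoint p0 p1 q0 q1 -> p0 <> q0.
Proof.
case: p0 q0 => [a b] [c d] h e; apply: (h 0 0); try lra.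
by rewrite -e /point_at; congr pair; rewrite /=; ring.
Qed.

Lemma point_at_line (p q : R * R) (x : R) : p.1 < q.1 -> p.1 <= x <= q.1 ->
  exists2 a, 0 <= a <= 1 & point_at p q a = (x, line_at p q x).
Proof.
move=> pq hx; exists ((x - p.1) / (q.1 - p.1)).
  split; first by apply: Rle_mult_inv_pos; lra.
  by apply: (Rmult_le_reg_r (q.1 - p.1)); [lra|]; field_simplify; lra.
by rewrite /point_at /line_at; congr pair; field; lra.
Qed.

Lemma vertical_point (p q : R * R) (y : R) : p.1 = q.1 -> p.2 <= y <= q.2 ->
  exists2 a, 0 <= a <= 1 & point_at p q a = (p.1, y).
Proof.
move=> epq hy; have [e|ne] := Req_dec p.2 q.2.
  by exists 0; [lra|rewrite /point_at; congr pair; lra].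
exists ((y - p.2) / (q.2 - p.2)).
  split; first by apply: Rle_mult_inv_pos; lra.
  by apply: (Rmult_le_reg_l (q.2 - p.2)); [lra|]; field_simplify; lra.
by rewrite /point_at; congr pair; [rewrite epq; lra|field; lra].
Qed.

(** This disposes of vertical segments: the slope in [line_at] is then a division by zero, but its
    value matters to [above] only for a point of the segment itself. *)
Lemma vertical_between (p q r : R * R) : p.1 = q.1 -> ltlex r p != ltlex r q ->
  exists2 a, 0 <= a <= 1 & point_at p q a = r.
Proof.
wlog lt : p q / p.2 <= q.2 => [hw epq nrpq|].
  case: (Rle_dec p.2 q.2) => [le|nle]; first exact: hw.
  have [||| a ha <-] := hw q p; [lra | by [] | by rewrite eq_sym |].
  by exists (1 - a); [lra | rewrite -point_atC].
move=> epq nr; have [e1 ly] : r.1 = p.1 /\ p.2 <= r.2 <= q.2.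
  by move: nr; case: ltlexP; case: ltlexP => // h1 h2 _; lra.
have [a ha ea] := vertical_point epq ly; exists a => //.
by rewrite ea -e1; case: (r).
Qed.

Lemma aboveC (p q r : R * R) : (forall a, 0 <= a <= 1 -> point_at p q a <> r) ->
  above p q r = above q p r.
Proof.
rewrite /above (addbC (ltlex r q)) => h.
case: (boolP (ltlex r p (+) ltlex r q)) => //= hr.
rewrite line_atC // => epq; have [|a ha /h] := vertical_between epq (r := r); last by [].
by case: ltlex hr; case: ltlex.
Qed.

(** An intermediate value theorem for the difference of two affine functions. When the slopes agree,
    the difference is constant and of both weak signs, hence zero. *)
Lemma affine_root (p0 p1 q0 q1 : R * R) (l r : R) : l <= r ->
  line_at p0 p1 l <= line_at q0 q1 l -> line_at q0 q1 r <= line_at p0 p1 r ->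
  exists2 x, l <= x <= r & line_at p0 p1 x = line_at q0 q1 x.
Proof.
rewrite /line_at.
move: (_ / (p1.1 - _)) => m; move: (_ / (q1.1 - _)) => k lr hl hr.
have [elr|nlr] := Req_dec l r; first by exists l; rewrite -?elr in hr *; lra.
have [e|ne] := Req_dec (m - k) 0.
  exists l; first lra.
  have : (m - k) * (r - l) = 0 by rewrite e; ring.
  nra.
(* The two lines meet where [(m - k) * x = c]. *)
pose c := (q0.2 - k * q0.1) - (p0.2 - m * p0.1).
have [x ex] : exists x, (m - k) * x = c by exists (c / (m - k)); field.
exists x; last by rewrite /c in ex; lra.
have h : (m - k) * l <= c <= (m - k) * r by rewrite /c; lra.
have pos : 0 < m - k by case: (Rlt_dec 0 (m - k)) => // hn; nra.
by split; apply: (Rmult_le_reg_l (m - k)); rewrite ?ex; lra.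
Qed.

Lemma disjoint_lines (p0 p1 q0 q1 : R * R) (x : R) : seg_disjoint p0 p1 q0 q1 ->
  p0.1 < p1.1 -> q0.1 < q1.1 -> p0.1 <= x <= p1.1 -> q0.1 <= x <= q1.1 ->
  line_at p0 p1 x <> line_at q0 q1 x.
Proof.
move=> dis hp hq hpx hqx e.
have [a ha ea] := point_at_line hp hpx; have [b hb eb] := point_at_line hq hqx.
by apply: (dis a b) => //; rewrite ea eb e.
Qed.

(** Three positions remain. If [q0] comes after [p1], both sides vanish. If the range of [q0 q1] is
    nested in that of [p0 p1], then [q0] and [q1] are on the same side of [p0 p1]. If the ranges
    interleave, exactly one of [q0] below [p0 p1] and [p1] below [q0 q1] holds. Any other pattern
    produces a common point. *)
Lemma parity_sorted (p0 p1 q0 q1 : R * R) : seg_disjoint p0 p1 q0 q1 ->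
  ~~ ltlex p1 p0 -> ~~ ltlex q1 q0 -> ltlex p0 q0 ->
  (ltlex q0 p0 (+) ltlex q0 p1) (+) (ltlex q1 p0 (+) ltlex q1 p1) =
  (above p0 p1 q0 (+) above p0 p1 q1) (+) (above q0 q1 p0 (+) above q0 q1 p1).
Proof.
move=> dis sp sq lpq.
have trans (a b c : R * R) : ltlex a b -> ~~ ltlex c b -> ltlex a c.
  by case: ltlexP => // ? _; case: ltlexP => // ? _; case: ltlexP => // ?; lra.
have antis (a b : R * R) : ltlex a b -> ltlex b a = false.
  by case: ltlexP => // ? _; case: ltlexP => // ?; lra.
have trans' (a b c : R * R) : ~~ ltlex b a -> ltlex b c -> ltlex a c.
  by case: ltlexP => // ? _; case: ltlexP => // ? _; case: ltlexP => // ?; lra.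
have l01 : ltlex p0 q1 := trans _ _ _ lpq sq.
rewrite (antis _ _ lpq) (antis _ _ l01) /=.
have -> : above q0 q1 p0 = false by rewrite /above lpq l01.
have n11 := seg_disjoint_end (seg_disjointCl (seg_disjointCr dis)).
have n10 := seg_disjoint_end (seg_disjointCl dis).
(* A vertical [p0 p1] would contain [q0]. *)
have vp : ltlex q0 p1 -> p0.1 < p1.1.
  move=> h; case: (Rlt_dec p0.1 p1.1) => // hn.
  have e : p0.1 = p1.1 by case: ltlexP sp => // h1 _; lra.
  have [|a ha ea] := vertical_between e (r := q0).
    by rewrite (antis _ _ lpq) h.
  case: (dis a 0 ha); first lra.
  by rewrite ea /point_at; case: (q0) => a1 a2 /=; congr pair; ring.
have [l|l] := boolP (ltlex q0 p1); last first.
  have l1 : ltlex p1 q0 by rewrite ltlex_total ?(negbTE l) // => e; case: n10.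
  have l2 := trans _ _ _ l1 sq.
  by rewrite /above (negbTE l) (antis _ _ lpq) (antis _ _ l01) (antis _ _ l2) l1 l2.
move: (vp l) => {}vp.
have ly : q0.1 <= p1.1 /\ p0.1 <= q0.1 by move: l lpq; case: ltlexP => // ? _;
  case: ltlexP => // ? _; lra.
(* Nested ranges first; a vertical [q0 q1] with ends on different sides meets [p0 p1] at its own
   abscissa. *)
have [m|m] := boolP (ltlex q1 p1).
  rewrite /above (antis _ _ lpq) (antis _ _ l01) (antis _ _ l) (antis _ _ m) l m /= addbF.
  have mx : q0.1 <= q1.1 <= p1.1 by move: m sq; case: ltlexP => // ? _; case: ltlexP => // ? _;
    lra.
  have [e|ne] := Req_dec q0.1 q1.1.
    have le2 : q0.2 <= q1.2 by case: ltlexP sq => // ? _; lra.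
    rewrite -e; case: ltRP => h1; case: ltRP => h2 //; last lra.
    have [|b hb eb] := vertical_point (y := line_at p0 p1 q0.1) e; first lra.
    have [|a ha ea] := point_at_line (x := q0.1) vp; first lra.
    by case: (dis a b) => //; rewrite ea eb.
  have vq : q0.1 < q1.1 by lra.
  have eq0 : line_at q0 q1 q0.1 = q0.2 by rewrite /line_at; field; lra.
  have eq1 : line_at q0 q1 q1.1 = q1.2 by rewrite /line_at; field; lra.
  case: ltRP => h1; case: ltRP => h2 //.
  - have [|||x hx ex] := @affine_root q0 q1 p0 p1 q0.1 q1.1; try lra.
    by case: (disjoint_lines (x := x) dis) => //; lra.
  - have [|||x hx ex] := @affine_root p0 p1 q0 q1 q0.1 q1.1; try lra.
    by case: (disjoint_lines (x := x) dis) => //; lra.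
(* Interleaved ranges: the two lines are compared at [q0.1] and at [p1.1], between which their order
   cannot change. *)
have m' : ltlex p1 q1 by rewrite ltlex_total ?(negbTE m) // => e; case: n11.
rewrite /above (antis _ _ lpq) (antis _ _ l01) (antis _ _ l) (negbTE m) l m' /=.
have vq : q0.1 < q1.1.
  case: (Rlt_dec q0.1 q1.1) => // hn.
  have e : q0.1 = q1.1 by case: ltlexP sq => // h1 _; lra.
  have [|a ha ea] := vertical_between e (r := p1).
    by rewrite (antis _ _ l) m'.
  case: (dis 1 a _ ha); first lra.
  by rewrite ea /point_at; case: (p1) => a1 a2 /=; congr pair; ring.
have mx : p1.1 <= q1.1 by move: m'; case: ltlexP => // ? _; lra.
have eq0 : line_at q0 q1 q0.1 = q0.2 by rewrite /line_at; field; lra.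
have ep1 : line_at p0 p1 p1.1 = p1.2 by rewrite /line_at; field; lra.
case: ltRP => h1; case: ltRP => h2 //.
- have [|||x hx ex] := @affine_root q0 q1 p0 p1 q0.1 p1.1; try lra.
  by case: (disjoint_lines (x := x) dis) => //; lra.
- have [|||x hx ex] := @affine_root p0 p1 q0 q1 q0.1 p1.1; try lra.
  by case: (disjoint_lines (x := x) dis) => //; lra.
Qed.

(** Reversing a segment only permutes terms, by [aboveC], and exchanging the segments flips all four
    comparisons, an even number; so the sorted case suffices. *)
Lemma seg_parity (p0 p1 q0 q1 : R * R) : seg_disjoint p0 p1 q0 q1 ->
  (ltlex q0 p0 (+) ltlex q0 p1) (+) (ltlex q1 p0 (+) ltlex q1 p1) =
  (above p0 p1 q0 (+) above p0 p1 q1) (+) (above q0 q1 p0 (+) above q0 q1 p1).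
Proof.
have endP (a b c d : R * R) : seg_disjoint a b c d ->
    forall t, 0 <= t <= 1 -> point_at a b t <> c.
  move=> h t ht e; apply: (h t 0 ht); first lra.
  by rewrite e /point_at; case: (c) => c1 c2; congr pair => /=; ring.
wlog sp : p0 p1 / ~~ ltlex p1 p0 => [hw dis|].
  have [l|] := boolP (ltlex p1 p0); last by move=> l; apply: hw.
  have l' : ~~ ltlex p0 p1.
    by move: l; case: ltlexP => // ? _; case: ltlexP => // ?; lra.
  have := hw _ _ l' (seg_disjointCl dis).
  rewrite (aboveC (endP _ _ _ _ dis)) (aboveC (endP _ _ _ _ (seg_disjointCr dis))).
  rewrite (addbC (ltlex q0 p1)) (addbC (ltlex q1 p1)) => ->.
  by rewrite (addbC (above q0 q1 p0)).
wlog sq : q0 q1 / ~~ ltlex q1 q0 => [hw dis|dis].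
  have [l|] := boolP (ltlex q1 q0); last by move=> l; apply: hw.
  have l' : ~~ ltlex q0 q1.
    by move: l; case: ltlexP => // ? _; case: ltlexP => // ?; lra.
  have := hw _ _ l' (seg_disjointCr dis).
  have dis' := seg_disjointC dis.
  rewrite (aboveC (endP _ _ _ _ dis')) (aboveC (endP _ _ _ _ (seg_disjointCr dis'))).
  rewrite (addbC (_ (+) _) (ltlex q0 p0 (+) _)) => ->.
  by rewrite (addbC (above p0 p1 q0)).
have [l|l] := boolP (ltlex p0 q0); first exact: parity_sorted.
have n00 : p0 <> q0 := seg_disjoint_end dis.
have n10 := seg_disjoint_end (seg_disjointCl dis).
have n01 := seg_disjoint_end (seg_disjointCr dis).
have n11 := seg_disjoint_end (seg_disjointCl (seg_disjointCr dis)).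
have l' : ltlex q0 p0 by rewrite ltlex_total.
have := parity_sorted (seg_disjointC dis) sq sp l'.
rewrite (ltlex_total n00) (ltlex_total n10) (ltlex_total n01) (ltlex_total n11).
rewrite (addbC (_ (+) _) (above p0 p1 q0 (+) _)) => <-.
by do 4!case: ltlex.
Qed.

Fixpoint path_above (P : nat -> R * R) (n : nat) (r : R * R) : bool :=
  if n is m.+1 then path_above P m r (+) above (P m) (P m.+1) r else false.

(** Both sides are additive under concatenation, since the terms at an intermediate vertex occur
    twice. [Q] is first built up against a single segment of [P], then [P] is built up. *)
Lemma path_parity (P Q : nat -> R * R) (n m : nat) :
  (forall k l, (k < n)%N -> (l < m)%N -> seg_disjoint (P k) (P k.+1) (Q l) (Q l.+1)) ->
  (ltlex (Q 0%N) (P 0%N) (+) ltlex (Q 0%N) (P n)) (+)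
    (ltlex (Q m) (P 0%N) (+) ltlex (Q m) (P n)) =
  (path_above P n (Q 0%N) (+) path_above P n (Q m)) (+)
    (path_above Q m (P 0%N) (+) path_above Q m (P n)).
Proof.
elim: n => [|n IH] dis /=; first by rewrite !addbb.
have seg k : (k <= m)%N ->
    (ltlex (Q 0%N) (P n) (+) ltlex (Q 0%N) (P n.+1)) (+)
      (ltlex (Q k) (P n) (+) ltlex (Q k) (P n.+1)) =
    (above (P n) (P n.+1) (Q 0%N) (+) above (P n) (P n.+1) (Q k)) (+)
      (path_above Q k (P n) (+) path_above Q k (P n.+1)).
  elim: k => [|k IHk] hk /=; first by rewrite !addbb.
  have /eq_addb h1 := IHk (ltnW hk).
  have /eq_addb h2 := seg_parity (dis n k (ltnSn n) hk).
  by apply/eq_addb; apply: (etrans _ (congr2 addb h1 h2)); ring.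
have /eq_addb h1 := IH (fun k l hk => dis k l (ltnW hk)).
have /eq_addb h2 := seg m (leqnn m).
by apply/eq_addb; apply: (etrans _ (congr2 addb h1 h2)); ring.
Qed.

(** * The parity obstruction to planarity *)

Definition dist1 (p q : R * R) : R := Rabs (p.1 - q.1) + Rabs (p.2 - q.2).

Lemma dist1_triangle (p q r : R * R) : dist1 p r <= dist1 p q + dist1 q r.
Proof.
rewrite /dist1; move: (Rabs_triang (p.1 - q.1) (q.1 - r.1)).
have -> : p.1 - q.1 + (q.1 - r.1) = p.1 - r.1 by ring.
move: (Rabs_triang (p.2 - q.2) (q.2 - r.2)).
have -> : p.2 - q.2 + (q.2 - r.2) = p.2 - r.2 by ring.
lra.
Qed.

Lemma dist1C (p q : R * R) : dist1 p q = dist1 q p.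
Proof. by rewrite /dist1 (Rabs_minus_sym p.1) (Rabs_minus_sym p.2). Qed.

Lemma dist1_gt0 (p q : R * R) : p <> q -> 0 < dist1 p q.
Proof.
case: p q => [p1 p2] [q1 q2] ne; rewrite /dist1 /=.
have := Rabs_pos (p1 - q1); have := Rabs_pos (p2 - q2).
have [e1|n1] := Req_dec p1 q1; last by have := Rabs_pos_lt (p1 - q1); lra.
have [e2|n2] := Req_dec p2 q2; last by have := Rabs_pos_lt (p2 - q2); lra.
by case: ne; rewrite e1 e2.
Qed.

Definition curve_continuous (F : R -> R * R) : Prop :=
  continuity (fun t => fst (F t)) /\ continuity (fun t => snd (F t)).

Lemma curve_continuous_dist1 (F : R -> R * R) (s e : R) : curve_continuous F -> 0 < e ->
  exists2 d, 0 < d & forall t, Rabs (t - s) < d -> dist1 (F t) (F s) < e.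
Proof.
move=> [c1 c2] e0.
have [|d1 [d1p h1]] := c1 s (e / 2); first lra.
have [|d2 [d2p h2]] := c2 s (e / 2); first lra.
exists (Rmin d1 d2); first by apply: Rmin_pos.
move=> t ht; have := Rmin_l d1 d2; have := Rmin_r d1 d2 => hr hl.
have [->|ne] := Req_dec t s; first by rewrite /dist1 !Rminus_diag Rabs_R0; lra.
have dx : D_x no_cond s t by split=> // e1; apply: ne.
have k1 : Rabs ((F t).1 - (F s).1) < e / 2 by apply: h1; split=> //; apply: Rlt_le_trans hl.
have k2 : Rabs ((F t).2 - (F s).2) < e / 2 by apply: h2; split=> //; apply: Rlt_le_trans hr.
by rewrite /dist1; lra.
Qed.

Lemma continuity_dist1 (F : R -> R * R) (p : R * R) : curve_continuous F ->
  continuity (fun t => dist1 p (F t)).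
Proof.
move=> [c1 c2]; apply: continuity_plus.
  by apply: (@continuity_comp (fun t => p.1 - fst (F t)) Rabs); [apply: continuity_minus => //;
    apply: continuity_const|apply: Rcontinuity_abs].
by apply: (@continuity_comp (fun t => p.2 - snd (F t)) Rabs); [apply: continuity_minus => //;
  apply: continuity_const|apply: Rcontinuity_abs].
Qed.

(** Compactness, through two nested one-variable minima: the inner minimum [m s] changes by at most
    the displacement of [F s], so it is continuous and attains its own minimum. *)
Lemma curves_apart (F G : R -> R * R) : curve_continuous F -> curve_continuous G ->
  (forall s t, 0 <= s <= 1 -> 0 <= t <= 1 -> F s <> G t) ->
  exists2 d, 0 < d & forall s t, 0 <= s <= 1 -> 0 <= t <= 1 -> d <= dist1 (F s) (G t).
Proof.
move=> cF cG dis.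
have minG s : {t | 0 <= t <= 1 /\
    forall u, 0 <= u <= 1 -> dist1 (F s) (G t) <= dist1 (F s) (G u)}.
  apply: constructive_indefinite_description.
  have [||t [h1 h2]] := @continuity_ab_min (fun t => dist1 (F s) (G t)) 0 1; first lra.
    by move=> c _; apply: continuity_dist1.
  by exists t.
pose m s := dist1 (F s) (G (sval (minG s))).
have mle s s' : m s <= m s' + dist1 (F s) (F s').
  have := proj2 (svalP (minG s)) _ (proj1 (svalP (minG s'))); rewrite -/(m s).
  have := dist1_triangle (F s) (F s') (G (sval (minG s'))); rewrite -/(m s'); lra.
have [||s0 [h1 h2]] := @continuity_ab_min m 0 1; first lra.
  move=> c _ e e0; have [d d0 hd] := curve_continuous_dist1 c cF e0.
  exists d; split=> // t [_ ht]; apply: Rle_lt_trans (hd t ht).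
  apply: Rabs_le; have := mle c t; have := mle t c; rewrite (dist1C (F c)); lra.
exists (m s0); first by apply: dist1_gt0; apply: dis => //; exact: (proj1 (svalP (minG s0))).
move=> s t hs ht; apply: Rle_trans (h1 s hs) _.
exact: (proj2 (svalP (minG s))).
Qed.

Lemma curve_uniform (F : R -> R * R) (e : R) : curve_continuous F -> 0 < e ->
  exists2 d, 0 < d & forall s t, 0 <= s <= 1 -> 0 <= t <= 1 -> Rabs (s - t) < d ->
    dist1 (F s) (F t) < e.
Proof.
move=> [c1 c2] e0; have e2 : 0 < e / 2 by lra.
have [d1 h1] := Heine _ _ (compact_P3 0 1) (fun x _ => c1 x) (mkposreal _ e2).
have [d2 h2] := Heine _ _ (compact_P3 0 1) (fun x _ => c2 x) (mkposreal _ e2).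
exists (Rmin d1 d2); first by apply: Rmin_pos; apply: cond_pos.
move=> s t hs ht hst; have := Rmin_l d1 d2; have := Rmin_r d1 d2 => hr hl.
have := h1 s t hs ht (Rlt_le_trans _ _ _ hst hl).
have := h2 s t hs ht (Rlt_le_trans _ _ _ hst hr).
by rewrite /dist1 /=; lra.
Qed.

Definition sample (F : R -> R * R) (n k : nat) : R * R := F (INR k / INR n).

Lemma sample0 (F : R -> R * R) (n : nat) : sample F n 0 = F 0.
Proof. by rewrite /sample /Rdiv Rmult_0_l. Qed.

Lemma sample_last (F : R -> R * R) (n : nat) : (0 < n)%N -> sample F n n = F 1.
Proof. by move=> n0; rewrite /sample Rdiv_diag //; apply: not_0_INR => e; rewrite e in n0. Qed.

Lemma point_at_dist1 (p q : R * R) (a : R) : 0 <= a <= 1 ->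
  dist1 p (point_at p q a) <= dist1 p q.
Proof.
move=> ha; rewrite /dist1 /=.
have -> (x y : R) : x - (x + a * (y - x)) = a * (x - y) by ring.
have -> (x y : R) : x - (x + a * (y - x)) = a * (x - y) by ring.
rewrite !Rabs_mult (Rabs_right a); last lra.
have := Rabs_pos (p.1 - q.1); have := Rabs_pos (p.2 - q.2).
move: (Rabs _) (Rabs _) => u v hu hv; nra.
Qed.

Lemma INR_ratio_bound (j n : nat) : (j <= n)%N -> (0 < n)%N -> 0 <= INR j / INR n <= 1.
Proof.
move=> /leP /le_INR hj /ltP /lt_0_INR n0; have := pos_INR j => j0.
split; first exact: Rle_mult_inv_pos.
by apply: (Rmult_le_reg_r (INR n)) => //; field_simplify; lra.
Qed.

Lemma sample_step (F : R -> R * R) (e : R) : curve_continuous F -> 0 < e ->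
  exists n0, forall n, (n0 <= n)%N -> forall k, (k < n)%N ->
    dist1 (sample F n k) (sample F n k.+1) < e.
Proof.
move=> cF e0; have [d d0 hd] := curve_uniform cF e0.
have [n0 [hn0 /ltP n00]] := archimed_cor1 d d0.
exists n0 => n hn k hk; have n0' : 0 < INR n.
  by apply: lt_0_INR; apply/ltP; apply: leq_trans hn.
have n0n : (0 < n)%N := leq_ltn_trans (leq0n _) hk.
apply: hd; [exact/INR_ratio_bound/n0n/ltnW | exact: INR_ratio_bound |].
rewrite S_INR; have -> : INR k / INR n - (INR k + 1) / INR n = - / INR n by field; lra.
rewrite Rabs_Ropp Rabs_right; last by apply/Rle_ge/Rlt_le/Rinv_0_lt_compat.
apply: Rle_lt_trans hn0; apply: Rinv_le_contravar; first by apply: lt_0_INR; apply/ltP.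
by apply: le_INR; apply/leP.
Qed.

(** Once the sampling steps are shorter than half the gap [d], a point common to two segments would
    bring two sample points closer than [d]. *)
Lemma samples_disjoint (F G : R -> R * R) : curve_continuous F -> curve_continuous G ->
  (forall s t, 0 <= s <= 1 -> 0 <= t <= 1 -> F s <> G t) ->
  exists n0, forall n, (n0 <= n)%N -> forall k l, (k < n)%N -> (l < n)%N ->
    seg_disjoint (sample F n k) (sample F n k.+1) (sample G n l) (sample G n l.+1).
Proof.
move=> cF cG dis; have [d d0 hd] := curves_apart cF cG dis.
have e0 : 0 < d / 2 by lra.
have [n1 h1] := sample_step cF e0; have [n2 h2] := sample_step cG e0.
exists (maxn n1 n2) => n; rewrite geq_max => /andP [l1 l2] k l hk hl a b ha hb e.
have := h1 n l1 k hk; have := h2 n l2 l hl.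
have := point_at_dist1 (sample F n k) (sample F n k.+1) ha.
have := point_at_dist1 (sample G n l) (sample G n l.+1) hb.
rewrite -e (dist1C (sample G n l) (point_at _ _ a)).
have := dist1_triangle (sample F n k) (point_at (sample F n k) (sample F n k.+1) a) (sample G n l).
suff : d <= dist1 (sample F n k) (sample G n l) by lra.
by apply: hd; apply: INR_ratio_bound; [apply: ltnW| |apply: ltnW|];
  rewrite ?(leq_ltn_trans (leq0n _) hk).
Qed.

(* Edges of [e] with a common reference order [lt] of the vertices: [x a b c]
   is the parity of the number of times the edge [ab] passes above [c].  Two
   disjoint edges never cross, so their endpoints interleave exactly when these
   parities say so. *)
Definition parity_system (T : finType) (e : rel T) (lt : rel T) (x : T -> T -> T -> bool) :=
  (forall a b, a != b -> lt b a = ~~ lt a b) /\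
  forall a b c d, e a b -> e c d -> a != c -> a != d -> b != c -> b != d ->
    (lt c a (+) lt c b) (+) (lt d a (+) lt d b) =
    (x a b c (+) x a b d) (+) (x c d a (+) x c d b).

Lemma planar_parity_system (T : finType) (e : rel T) : planar e ->
  exists lt x, parity_system e lt x.
Proof.
move=> [pos [arc [inj [hv he]]]].
pose good (q : T * T * T * T) n := let: (a, b, c, d) := q in
  e a b -> e c d -> a != c -> a != d -> b != c -> b != d ->
  forall k l, (k < n)%N -> (l < n)%N ->
    seg_disjoint (sample (arc a b) n k) (sample (arc a b) n k.+1)
                 (sample (arc c d) n l) (sample (arc c d) n l.+1).
have ex_good q : exists n0, forall n, (n0 <= n)%N -> good q n.
  case: q => [[[a b] c] d].
  case: (boolP [&& e a b, e c d, a != c, a != d, b != c & b != d]); last first.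
    by move=> h; exists 0%N => n _ h1 h2 h3 h4 h5 h6; case/negP: h; rewrite h1 h2 h3 h4 h5 h6.
  case/and5P=> eab ecd ac ad /andP [bc bd].
  have [F1 [F2 [Fa [Fb [_ Fi]]]]] := hv _ _ eab.
  have [G1 [G2 [Gc [Gd [_ Gi]]]]] := hv _ _ ecd.
  have npos u v : u != v -> pos u <> pos v by move=> /eqP uv /inj.
  have [||s t hs ht|n0 hn0] := @samples_disjoint (arc a b) (arc c d); [by []|by []| |];
    last first.
    by exists n0 => n hn _ _ _ _ _ _; apply: hn0.
  (* A drawing separates open arcs from each other and from the vertices, so each parameter is split
     into the two ends and the interior. *)
  have trich r : 0 <= r <= 1 -> r = 0 \/ r = 1 \/ 0 < r < 1 by lra.
  case: (trich s hs) => [->|[->|{}hs]]; rewrite ?Fa ?Fb;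
    case: (trich t ht) => [->|[->|{}ht]]; rewrite ?Gc ?Gd.
  all: try exact: npos.
  all: try (by apply/nesym; exact: Gi).
  all: try exact: Fi.
  apply: he => //; case=> [[ac' _]|[ad' _]]; first by rewrite ac' eqxx in ac.
  by rewrite ad' eqxx in ad.
(* One sampling rate for all quadruples turns each arc into one fixed polygonal line, so that the
   parity [x a b c] does not depend on the edge compared with [ab]. *)
have [N N0 hN] : exists2 n, (0 < n)%N & forall q, good q n.
  pose f q := sval (constructive_indefinite_description _ (ex_good q)).
  exists (\max_q f q).+1 => // q.
  apply: (svalP (constructive_indefinite_description _ (ex_good q))).
  by apply: leqW; apply: (leq_bigmax q).
exists (fun a b => ltlex (pos a) (pos b)).
exists (fun a b c => path_above (sample (arc a b) N) N (pos c)).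
split=> [a b /eqP ab|a b c d eab ecd ac ad bc bd]; first by rewrite ltlex_total // => /inj.
have [_ [_ [Fa [Fb _]]]] := hv _ _ eab; have [_ [_ [Gc [Gd _]]]] := hv _ _ ecd.
have := path_parity (hN (a, b, c, d) eab ecd ac ad bc bd).
by rewrite !sample0 !sample_last // Fa Fb Gc Gd.
Qed.

End Plane.

(* The equation of [parity_system] for a curve from [u] to [v] and a curve from
   [w] to [z], where [X r], [Y r] are the parities with which they pass above [r]. *)
Definition non_crossing (T : Type) (lt : rel T) (X : T -> bool) (u v : T)
    (Y : T -> bool) (w z : T) : bool :=
  (lt w u (+) lt w v (+) (lt z u (+) lt z v)) (+) (X w (+) X z (+) (Y u (+) Y v)) == false.

(** The terms at the junction [m] cancel, so a subdivided edge behaves as a single curve. *)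
Lemma non_crossing_cat (T : Type) (lt : rel T) (X Y Y' : T -> bool) (u v w m z : T) :
  non_crossing lt X u v Y w m -> non_crossing lt X u v Y' m z ->
  non_crossing lt X u v (fun r => Y r (+) Y' r) w z.
Proof.
move=> /eqP h1 /eqP h2; apply/eqP; apply: (etrans _ (congr2 addb h1 h2)); ring.
Qed.

Definition disjoint_pairs (s : seq (nat * nat)) (p : pred ((nat * nat) * (nat * nat))) :=
  [seq q <- [seq (x, y) | x <- s, y <- s] | p q].

Lemma addb_foldr0 (A : eqType) (E : A -> bool) (s : seq A) :
  {in s, forall q, E q = false} -> foldr (fun q b => E q (+) b) false s = false.
Proof.
elim: s => //= q s IH h; rewrite h ?mem_head // IH // => r hr.
by rewrite h // inE hr orbT.
Qed.

(** The 18 equations are added. A vertex off an edge is an end of exactly two edges disjoint from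
    it, so every value of [X] cancels. The comparison of two given vertices also occurs evenly
    often, and orienting all 15 of them uniformly with [tot'] leaves an odd number of constants. *)
Lemma K33_crossing (T : eqType) (lt : rel T) (a b : nat -> T) (X : nat -> nat -> T -> bool) :
  (forall u v, u != v -> lt v u = ~~ lt u v) ->
  uniq [:: a 0; a 1; a 2; b 0; b 1; b 2] ->
  ~ (forall i j k l, i < k -> k < 3 -> j < 3 -> l < 3 -> j != l ->
     non_crossing lt (X i j) (a i) (b j) (X k l) (a k) (b l)).
Proof.
move=> tot un h.
pose E (q : (nat * nat) * (nat * nat)) := let: ((i, j), (k, l)) := q in
  (lt (a k) (a i) (+) lt (a k) (b j) (+) (lt (b l) (a i) (+) lt (b l) (b j))) (+)
  (X i j (a k) (+) X i j (b l) (+) (X k l (a i) (+) X k l (b j))).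
pose s := disjoint_pairs [seq (i, j) | i <- iota 0 3, j <- iota 0 3]
  (fun q => (q.1.1 < q.2.1) && (q.1.2 != q.2.2)).
have : foldr (fun q b => E q (+) b) false s = false.
  have /allP as_ : all (fun q => [&& q.1.1 < q.2.1, q.2.1 < 3, q.1.2 < 3, q.2.2 < 3
      & q.1.2 != q.2.2]) s by [].
  by apply: addb_foldr0 => -[[i j] [k l]] /as_ /and5P [ik k3 j3 l3 jl]; apply/eqP/h.
have tot' u v : u != v -> lt v u = true (+) lt u v by move/tot.
let p := eval vm_compute in s in change s with p.
cbn [foldr]; rewrite /E.
move: un; rewrite /= !inE !negb_or -!andbA.
do 15!(case/andP; move/tot' => huv; rewrite ?huv {huv}); move=> _ sum0.
by have : true = false by rewrite -[RHS]sum0; ring.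
Qed.

(** The same cancellation over the 15 pairs of disjoint edges: each value of [X] occurs twice and
    each of the 10 comparisons six times, with an odd number of reversals. *)
Lemma K5_crossing (T : eqType) (lt : rel T) (a : nat -> T) (X : nat -> nat -> T -> bool) :
  (forall u v, u != v -> lt v u = ~~ lt u v) ->
  uniq [:: a 0; a 1; a 2; a 3; a 4] ->
  ~ (forall i j k l, i < j -> k < l -> j < 5 -> l < 5 -> i < k -> j != k -> j != l ->
     non_crossing lt (X i j) (a i) (a j) (X k l) (a k) (a l)).
Proof.
move=> tot un h.
pose E (q : (nat * nat) * (nat * nat)) := let: ((i, j), (k, l)) := q in
  (lt (a k) (a i) (+) lt (a k) (a j) (+) (lt (a l) (a i) (+) lt (a l) (a j))) (+)
  (X i j (a k) (+) X i j (a l) (+) (X k l (a i) (+) X k l (a j))).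
pose s := disjoint_pairs [seq p <- [seq (i, j) | i <- iota 0 5, j <- iota 0 5] | p.1 < p.2]
  (fun q => [&& q.1.1 < q.2.1, q.1.2 != q.2.1 & q.1.2 != q.2.2]).
have : foldr (fun q b => E q (+) b) false s = false.
  have /allP as_ : all (fun q => [&& q.1.1 < q.1.2, q.2.1 < q.2.2, q.1.2 < 5, q.2.2 < 5
      & [&& q.1.1 < q.2.1, q.1.2 != q.2.1 & q.1.2 != q.2.2]]) s by [].
  by apply: addb_foldr0 => -[[i j] [k l]] /as_ /and5P [ik k3 j3 l3 /and3P [jl1 jl2 jl3]];
    apply/eqP/h.
have tot' u v : u != v -> lt v u = true (+) lt u v by move/tot.
let p := eval vm_compute in s in change s with p.
cbn [foldr]; rewrite /E.
move: un; rewrite /= !inE !negb_or -!andbA.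
do 10!(case/andP; move/tot' => huv; rewrite ?huv {huv}); move=> _ sum0.
by have : true = false by rewrite -[RHS]sum0; ring.
Qed.

(** * Kuratowski graphs excluded from planar graphs *)

Section Kuratowski.
Variables (T : finType) (e : rel T).
Hypotheses (e_sym : symmetric e) (e_irr : irreflexive e) (pl : planar e).

Lemma adj_neq u v : e u v -> u != v.
Proof. by move=> h; apply/eqP => uv; rewrite uv e_irr in h. Qed.

Lemma parity_system_non_crossing lt x a b c d : parity_system e lt x ->
  e a b -> e c d -> a != c -> a != d -> b != c -> b != d ->
  non_crossing lt (x a b) a b (x c d) c d.
Proof. by move=> [_ h] *; apply/eqP; apply: (proj1 (eq_addb _ _)); exact: h. Qed.

Lemma no_K5 (v0 v1 v2 v3 v4 : T) : uniq [:: v0; v1; v2; v3; v4] ->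
  ~~ pairwise e [:: v0; v1; v2; v3; v4].
Proof.
move=> un; apply/negP => adj; have [lt [x ps]] := planar_parity_system pl.
pose a := nth v0 [:: v0; v1; v2; v3; v4].
have adj' i j : i < j -> j < 5 -> e (a i) (a j).
  by move=> ij j5; apply: (pairwiseP v0 adj); rewrite ?inE //; apply: ltn_trans j5.
have ne i j : i < 5 -> j < 5 -> i != j -> a i != a j.
  by move=> i5 j5; rewrite nth_uniq.
apply: (@K5_crossing T lt a (fun i j => x (a i) (a j)) ps.1) => //.
move=> i j k l ij kl j5 l5 ik jk jl.
have k5 := ltn_trans kl l5; have i5 := ltn_trans ij j5.
apply: parity_system_non_crossing => //; try exact: adj'; apply: ne => //.
  by rewrite ltn_eqF.
by rewrite ltn_eqF // (ltn_trans ik).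
Qed.

Lemma no_K33 (a0 a1 a2 b0 b1 b2 : T) :
  uniq [:: a0; a1; a2; b0; b1; b2] ->
  ~~ allrel e [:: a0; a1; a2] [:: b0; b1; b2].
Proof.
move=> un; apply/negP => /allrelP adj; have [lt [x ps]] := planar_parity_system pl.
pose s := [:: a0; a1; a2; b0; b1; b2].
have ne i j : i < 6 -> j < 6 -> i != j -> nth a0 s i != nth a0 s j.
  by move=> i5 j5; rewrite nth_uniq.
apply: (@K33_crossing T lt (nth a0 s) (fun j => nth a0 s (3 + j))
          (fun i j => x (nth a0 s i) (nth a0 s (3 + j))) ps.1) => //.
have adj' i j : i < 3 -> j < 3 -> e (nth a0 s i) (nth a0 s (3 + j)).
  by move=> i3 j3; apply: adj; case: i i3 j j3 => [|[|[|i]]] // _ [|[|[|j]]] // _;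
    rewrite !inE eqxx ?orbT.
move=> i j k l ik k3 j3 l3 jl; have i3 := ltn_trans ik k3.
apply: parity_system_non_crossing => //; try exact: adj'; apply: ne => //;
  rewrite ?ltn_add2l ?(leq_trans i3) ?(leq_trans k3) ?eqn_add2l //.
- by rewrite ltn_eqF.
- by rewrite ltn_eqF // ltn_addr.
- by rewrite gtn_eqF // ltn_addr.
Qed.

(* The case where the edge [a2 b2] is subdivided by [m]. *)
Lemma no_K33_path (a0 a1 a2 b0 b1 b2 m : T) :
  uniq [:: a0; a1; a2; b0; b1; b2; m] ->
  all (e a0) [:: b0; b1; b2] -> all (e a1) [:: b0; b1; b2] -> all (e a2) [:: b0; b1] ->
  e m b2 -> ~~ e a2 m.
Proof.
move=> un E0 E1 E2 mb; apply/negP => am; have [lt [x ps]] := planar_parity_system pl.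
pose s := [:: a0; a1; a2; b0; b1; b2; m].
have ne i j : i < 7 -> j < 7 -> i != j -> nth a0 s i != nth a0 s j.
  by move=> i5 j5; rewrite nth_uniq.
have adj i j : i < 3 -> j < 3 -> (i, j) != (2, 2) -> e (nth a0 s i) (nth a0 s (3 + j)).
  move: E0 E1 E2; rewrite /= !andbT => /and3P [? ? ?] /and3P [? ? ?] /andP [? ?].
  by case: i => [|[|[|i]]] //; case: j => [|[|[|j]]].
(* The edge with indices [(2, 2)] is the path [a2 m b2], whose parities are the sums along its two
   edges. *)
pose X i j := if (i, j) == (2, 2) then fun r => x a2 m r (+) x m b2 r
              else x (nth a0 s i) (nth a0 s (3 + j)).
apply: (@K33_crossing T lt (nth a0 s) (fun j => nth a0 s (3 + j)) X ps.1).
  exact: (take_uniq 6 un).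
move=> i j k l ik k3 j3 l3 jl; have i3 := ltn_trans ik k3.
(* Since [i < k < 3], only the second edge of a pair can be the subdivided one. *)
have ij : (i, j) != (2, 2) by rewrite xpair_eqE ltn_eqF // (leq_trans ik).
rewrite /X (negbTE ij); have side p : p < 3 -> p < 7 by move/leq_trans; apply.
have side' p : p < 3 -> 3 + p < 7 by move=> p3; rewrite (@leq_ltn_trans (3 + 2)) // leq_add2l.
have step p q : p < 7 -> q < 7 -> e (nth a0 s p) (nth a0 s q) ->
    [&& i != p, i != q, 3 + j != p & 3 + j != q] ->
  non_crossing lt (x (nth a0 s i) (nth a0 s (3 + j))) (nth a0 s i) (nth a0 s (3 + j))
    (x (nth a0 s p) (nth a0 s q)) (nth a0 s p) (nth a0 s q).
  move=> p7 q7 epq /and4P [h1 h2 h3 h4].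
  by apply: parity_system_non_crossing => //; [apply: adj | | | |]; try apply: ne => //; auto.
case: ifP => [/eqP [k2 l2]|/negbT kl].
  subst k l; have [n1 n2] : [&& i != 2, i != 6, 3 + j != 2 & 3 + j != 6] /\
      [&& i != 6, i != 5, 3 + j != 6 & 3 + j != 5].
    by case: i ik {ij i3 step} => [|[|i]] //; case: j j3 jl => [|[|[|j]]].
  exact: non_crossing_cat (step 2 6 isT isT am n1) (step 6 5 isT isT mb n2).
apply: step; [exact: side | exact: side' | exact: adj |].
rewrite eqn_add2l jl andbT (ltn_eqF ik) (@ltn_eqF i) ?(@gtn_eqF k (3 + j)) //.
  by apply: leq_trans k3 _; rewrite leq_addr.
by apply: leq_trans i3 _; rewrite leq_addr.
Qed.
End Kuratowski.

(** * Degrees in graphs without S_{2,4} *)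

Lemma subset_uniq_seq (T : finType) (A : {set T}) (k : nat) : k <= #|A| ->
  exists s, [/\ uniq s, size s = k & {subset s <= A}].
Proof.
move=> kA; exists (take k (enum A)); split; first by rewrite take_uniq ?enum_uniq.
  by rewrite size_takel // -cardE.
by move=> x /mem_take; rewrite mem_enum.
Qed.

Section Graph.
Variables (T : finType) (e : rel T).
Hypotheses (e_sym : symmetric e) (e_irr : irreflexive e).

Definition nbh (v : T) : {set T} := [set u | e v u].
Definition deg (v : T) : nat := #|nbh v|.
Definition cnbh (v : T) : {set T} := v |: nbh v.

Lemma in_nbh v u : (u \in nbh v) = e v u.
Proof. by rewrite inE. Qed.

Lemma in_cnbh v u : (u \in cnbh v) = (u == v) || e v u.
Proof. by rewrite !inE. Qed.

Section DoubleStarFree.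
Hypothesis free : ~ contains_subgraph e (double_star 2 4).

(** Four remaining neighbours of [y] would be its leaves in a double star with backbone [xy] and
    leaves [a1], [a2] at [x]. *)
Lemma double_star_free_leaves x y a1 a2 : e x y -> e x a1 -> e x a2 -> a1 != a2 ->
  a1 != y -> a2 != y -> #|nbh y :\: [set x; a1; a2]| <= 3.
Proof.
move=> xy xa1 xa2 a12 a1y a2y; rewrite leqNgt; apply/negP => /subset_uniq_seq.
case=> -[|b1 [|b2 [|b3 [|b4 [|? ?]]]]] [ub // _ sb]; apply: free.
have bP b : b \in [:: b1; b2; b3; b4] -> [/\ e y b, b != x, b != a1 & b != a2].
  by move/sb; rewrite !inE !negb_or -!andbA => /and4P [-> -> -> ->].
(* The order follows the numbering of [double_star]: backbone, then the leaves of [x], then those of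
   [y]. *)
pose s := [:: x; y; a1; a2; b1; b2; b3; b4].
have us : uniq s.
  rewrite /s -[_ :: _]/([:: x; y; a1; a2] ++ [:: b1; b2; b3; b4]) cat_uniq ub andbT.
  have ne u v : e u v -> u != v := @adj_neq _ _ e_irr u v.
  apply/andP; split.
    by rewrite /= !inE !negb_or a12 !(eq_sym y) a1y a2y !ne.
  apply/hasPn => b /bP [yb bx ba1 ba2]; rewrite !inE !negb_or bx ba1 ba2.
  by rewrite eq_sym ne.
exists (fun i => nth x s (val i)); split.
  by move=> i j /eqP; rewrite nth_uniq ?ltn_ord // => /eqP /val_inj.
have half i j : dstar_half 2 4 i j -> e (nth x s (val i)) (nth x s (val j)).
  have yb b : b \in [:: b1; b2; b3; b4] -> e y b by case/bP.
  have [yb1 yb2 yb3 yb4] : [/\ e y b1, e y b2, e y b3 & e y b4].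
    by split; apply: yb; rewrite !inE eqxx ?orbT.
  rewrite /dstar_half -!andbA => /or3P [/andP [/eqP -> /eqP ->]|/and3P [/eqP -> h1 h2]|
    /and3P [/eqP -> h1 h2]] //.
    by case: (val j) h1 h2 => [|[|[|[|k]]]].
  by case: (val j) h1 h2 => [|[|[|[|[|[|[|[|k]]]]]]]].
by move=> i j /orP [/half|/half] //; rewrite e_sym.
Qed.

(** Two neighbours of [x] outside [N[y]] would leave all four other neighbours of [y] free as
    leaves. *)
Lemma deg5_nbr x y : deg y = 5 -> e x y -> #|nbh x :\: cnbh y| <= 1.
Proof.
move=> dy xy; rewrite leqNgt; apply/negP => /card_gt1P [a1 [a2 []]].
rewrite !inE !negb_or => /andP [/andP [n1 f1] x1] /andP [/andP [n2 f2] x2] n12.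
have := double_star_free_leaves xy x1 x2 n12 n1 n2.
suff -> : nbh y :\: [set x; a1; a2] = nbh y :\ x.
  by have := cardsD1 x (nbh y); rewrite -/(deg y) dy inE e_sym xy; lia.
apply/setP => u; rewrite !inE; case: eqP => //= _.
by case: eqP => [->|_] /=; [rewrite (negbTE f1)|case: eqP => [->|//] /=; rewrite (negbTE f2)].
Qed.

(** A neighbour of [x] outside [N[y]], together with any further one, uses at most one of the five
    other neighbours of [y], leaving four leaves. *)
Lemma deg6_nbr x y : deg y = 6 -> e x y -> 2 < deg x -> nbh x \subset cnbh y.
Proof.
move=> dy xy dx; apply/subsetPn => -[a1]; rewrite !inE negb_or => xa1 /andP [n1 f1].
have : 0 < #|nbh x :\: [set y; a1]|.
  have := cardsD (nbh x) [set y; a1]; have := subset_leq_card (subsetIr (nbh x) [set y; a1]).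
  rewrite cards2 -/(deg x); lia.
case/card_gt0P => a2; rewrite !inE negb_or => /andP [/andP [n2 n12] x2].
have := double_star_free_leaves xy xa1 x2 _ n1 n2; rewrite eq_sym => /(_ n12).
have -> : nbh y :\: [set x; a1; a2] = nbh y :\: [set x; a2].
  apply/setP => u; rewrite !inE; case: (u == x) => //=.
  by case: eqP => [->|_] //=; rewrite (negbTE f1) andbF.
have := cardsD (nbh y) [set x; a2]; have := subset_leq_card (subsetIr (nbh y) [set x; a2]).
rewrite cards2 -/(deg y); lia.
Qed.

(** Two neighbours of [x] other than [y], and [x] itself, take at most three of the seven or more
    neighbours of [y]. *)
Lemma deg7_nbr x y : 6 < deg y -> e x y -> deg x <= 2.
Proof.
move=> dy xy; rewrite leqNgt; apply/negP => dx.
have : 1 < #|nbh x :\ y| by move: dx; rewrite /deg (cardsD1 y) inE xy.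
case/card_gt1P => a1 [a2 []]; rewrite !inE => /andP [n1 x1] /andP [n2 x2] n12.
have := double_star_free_leaves xy x1 x2 n12 n1 n2.
have := cardsD (nbh y) [set x; a1; a2]; have := subset_leq_card (subsetIr (nbh y) [set x; a1;
  a2]).
have : #|[set x; a1; a2]| <= 3.
  by rewrite setUC cardsU1 cards2; case: (_ \notin _); case: (_ != _).
rewrite -/(deg y); lia.
Qed.
End DoubleStarFree.
End Graph.

(** * The neighbourhood of a vertex of a planar graph *)

(* A graph on [0 .. m-1] as the list of its adjacency bits, in the order of the
   pairs (0,1), (0,2), (1,2), (0,3), ... *)
Definition adj_of_bits (l : bitseq) : rel nat := fun i j =>
  (i != j) && nth false l (if i < j then (j * j.-1)./2 + i else (i * i.-1)./2 + j).

Definition bits_of_adj (T : Type) (e : rel T) (f : nat -> T) (m : nat) : bitseq :=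
  [seq e (f i) (f j) | j <- iota 0 m, i <- iota 0 j].

Fixpoint all_bitseqs (m : nat) (P : bitseq -> bool) : bool :=
  if m is m'.+1 then
    all_bitseqs m' (fun l => P (true :: l)) && all_bitseqs m' (fun l => P (false :: l))
  else P [::].

Lemma all_bitseqsP m P : all_bitseqs m P -> forall l, size l = m -> P l.
Proof.
elim: m P => [|m IH] P /=; first by move=> h [].
by case/andP => ht hf [//|[] l] [sl]; [exact: (IH _ ht) | exact: (IH _ hf)].
Qed.

(* [&&] and [has] evaluate all their arguments under [vm_compute]; these variants
   do not. *)
Local Notation "a &&& b" := (if a then b else false) (at level 85, right associativity).

Fixpoint lazy_has (T : Type) (p : pred T) (s : seq T) : bool :=
  if s is x :: s' then if p x then true else lazy_has p s' else false.

Lemma lazy_hasE (T : Type) (p : pred T) (s : seq T) : lazy_has p s = has p s.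
Proof. by elim: s => //= x s ->; case: (p x). Qed.

(* [g] restricted to [s] contains [K_4], [K_{2,3}], or [K_{2,3}] with one edge
   subdivided, so that adding a vertex joined to all of [s] yields a nonplanar graph. *)
Definition K4_in (g : rel nat) (s : seq nat) :=
  lazy_has (fun i => lazy_has (fun j => g i j &&& lazy_has (fun k => g i k &&& g j k &&&
    lazy_has (fun l => g i l &&& g j l &&& g k l) s) s) s) s.

Definition K23_in (g : rel nat) (s : seq nat) :=
  lazy_has (fun p => lazy_has (fun q => p != q &&& 2 < count (fun x => g p x &&& g q x) s) s) s.

Definition K23_path_in (g : rel nat) (s : seq nat) :=
  lazy_has (fun p => lazy_has (fun q => p != q &&& lazy_has (fun x => g p x &&& x != q &&&
    lazy_has (fun m => g q m &&& g m x &&& m != p &&&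
      1 < count (fun y => g p y &&& g q y &&& y != x &&& y != m) s) s) s) s) s.

Definition apex_nonplanar g s :=
  if K4_in g s then true else if K23_in g s then true else K23_path_in g s.

(* The path [a b c d] together with a hub [h] joined to all of it; the arguments are
   the hub, then the inner vertices of the path, then its ends. *)
Definition fan (T : Type) (g : rel T) (h b c a d : T) :=
  all (g h) [:: a; b; c; d] && [&& g a b, g b c, g c d, ~~ g a c, ~~ g a d & ~~ g b d].

Definition in_deg (g : rel nat) (m i : nat) := count (g i) (iota 0 m).

(** The neighbourhood of a vertex in a planar graph is outerplanar, and 9 = 2 * 6 - 3 is the maximum
    number of edges of an outerplanar graph on six vertices. All [2^15] graphs are inspected. *)
Lemma six_vertices_check : all_bitseqs 15 (fun l =>
  if 9 < count id l then apex_nonplanar (adj_of_bits l) (iota 0 6) else true).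
Proof. by vm_compute. Qed.

(** Up to reversal, a fan with hub and inner vertices among 0, 1, 2 and ends 3, 4 is given by the
    hub and the order of the ends, hence six cases. *)
Lemma five_vertices_check : all_bitseqs 10 (fun l => let g := adj_of_bits l in
  if all (fun i => 2 < in_deg g 5 i) (iota 0 3) &&& all (fun i => 1 < in_deg g 5 i) (iota 3 2)
  then if apex_nonplanar g (iota 0 5) then true else
    [|| fan g 0 1 2 3 4, fan g 0 1 2 4 3, fan g 1 0 2 3 4,
      fan g 1 0 2 4 3, fan g 2 0 1 3 4 | fan g 2 0 1 4 3]
  else true).
Proof. by vm_compute. Qed.

Lemma card_setI_count (T : finType) (A B : {set T}) (s : seq T) :
  uniq s -> A =i s -> #|B :&: A| = count (mem B) s.
Proof.
move=> us sA; rewrite -size_filter -(card_uniqP _) ?filter_uniq //.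
by apply: eq_card => x; rewrite !inE mem_filter sA.
Qed.

Section Apex.
Variables (T : finType) (e : rel T).
Hypotheses (e_sym : symmetric e) (e_irr : irreflexive e) (pl : planar e).

Lemma adj_of_bitsE (f : nat -> T) m i j : m <= 6 -> i < m -> j < m ->
  adj_of_bits (bits_of_adj e f m) i j = e (f i) (f j).
Proof.
case: m => [|[|[|[|[|[|[|m]]]]]]] // _.
all: case: i => [|[|[|[|[|[|i]]]]]] // _; case: j => [|[|[|[|[|[|j]]]]]] // _.
all: by rewrite /adj_of_bits /= ?e_irr // e_sym.
Qed.

Section Vertex.
Variables (v : T) (f : nat -> T) (m : nat) (g : rel nat).
Hypotheses (f_inj : {in iota 0 m &, injective f}) (vf : {in iota 0 m, forall i, e v (f i)}).
Hypothesis gE : {in iota 0 m &, forall i j, g i j = e (f i) (f j)}.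

Let f_neq i j : i \in iota 0 m -> j \in iota 0 m -> i != j -> f i != f j.
Proof. by move=> si sj; apply: contraNneq => /(f_inj si sj) ->. Qed.

Let v_neq i : i \in iota 0 m -> v != f i.
Proof. by move=> si; apply: (adj_neq e_irr); exact: vf. Qed.

Let g_neq i j : i \in iota 0 m -> j \in iota 0 m -> g i j -> f i != f j.
Proof. by move=> si sj gij; apply: (adj_neq e_irr); rewrite -gE. Qed.

Lemma K4_in_nbh : ~~ K4_in g (iota 0 m).
Proof.
apply/negP; rewrite /K4_in lazy_hasE => /hasP [i si]; rewrite lazy_hasE => /hasP [j sj].
case: ifP => // ij; rewrite lazy_hasE => /hasP [k sk].
case: ifP => // ik; case: ifP => // jk; rewrite lazy_hasE => /hasP [l sl].
case: ifP => // il; case: ifP => // jl kl.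
have un : uniq [:: v; f i; f j; f k; f l].
  by rewrite /= !inE !negb_or !v_neq // !g_neq.
have := no_K5 pl un; rewrite /= !vf // -!gE //.
by rewrite ij ik jk il jl kl.
Qed.

Lemma K23_in_nbh : ~~ K23_in g (iota 0 m).
Proof.
apply/negP; rewrite /K23_in lazy_hasE => /hasP [p sp]; rewrite lazy_hasE => /hasP [q sq].
case: ifP => // pq; rewrite -size_filter.
case E : (filter _ _) => [|x1 [|x2 [|x3 s]]] // _.
have u : uniq [:: x1, x2, x3 & s] by rewrite -E filter_uniq ?iota_uniq.
have xP x : x \in [:: x1; x2; x3] -> [/\ x \in iota 0 m, e (f p) (f x) & e (f q) (f x)].
  move=> xs; have : x \in [:: x1, x2, x3 & s].
    by move: xs; rewrite !inE => /or3P [] ->; rewrite ?orbT.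
  rewrite -E mem_filter => /andP [h sx].
  by move: h; case: ifP => // h1 h2; rewrite -!gE.
have [s1 p1 q1] : [/\ x1 \in iota 0 m, e (f p) (f x1) & e (f q) (f x1)] by apply: xP;
  rewrite !inE eqxx.
have [s2 p2 q2] : [/\ x2 \in iota 0 m, e (f p) (f x2) & e (f q) (f x2)] by apply: xP;
  rewrite !inE eqxx orbT.
have [s3 p3 q3] : [/\ x3 \in iota 0 m, e (f p) (f x3) & e (f q) (f x3)] by apply: xP;
  rewrite !inE eqxx !orbT.
have un : uniq [:: v; f p; f q; f x1; f x2; f x3].
  move: u; rewrite /= !inE !negb_or -!andbA => /and5P [n12 n13 _ n23 _].
  by rewrite !v_neq // (f_neq sp sq pq) (f_neq s1 s2 n12) (f_neq s1 s3 n13)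
    (f_neq s2 s3 n23) !(adj_neq e_irr).
by have := no_K33 pl un; rewrite /allrel /= !vf // p1 p2 p3 q1 q2 q3.
Qed.

Lemma K23_path_in_nbh : ~~ K23_path_in g (iota 0 m).
Proof.
apply/negP; rewrite /K23_path_in lazy_hasE => /hasP [p sp]; rewrite lazy_hasE => /hasP [q sq].
case: ifP => // pq; rewrite lazy_hasE => /hasP [x sx].
case: ifP => // px; case: ifP => // xq; rewrite lazy_hasE => /hasP [k sk].
case: ifP => // qk; case: ifP => // kx; case: ifP => // kp; rewrite -size_filter.
case E : (filter _ _) => [|y1 [|y2 s]] // _.
have u : uniq [:: y1, y2 & s] by rewrite -E filter_uniq ?iota_uniq.
have yP y : y \in [:: y1; y2] -> [/\ y \in iota 0 m, e (f p) (f y), e (f q) (f y), y != x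
  & y != k].
  move=> ys; have : y \in [:: y1, y2 & s].
    by move: ys; rewrite !inE => /orP [] ->; rewrite ?orbT.
  rewrite -E mem_filter => /andP [h sy].
  by move: h; case: ifP => // h1; case: ifP => // h2; case: ifP => // h3 h4; rewrite -!gE.
have [|s1 p1 q1 n1 m1] := yP y1; first by rewrite inE eqxx.
have [|s2 p2 q2 n2 m2] := yP y2; first by rewrite !inE eqxx orbT.
have un : uniq [:: v; f p; f q; f y1; f y2; f x; f k].
  move: u; rewrite /= !inE !negb_or -!andbA => /and3P [n12 _ _].
  have := g_neq sk sx kx; rewrite eq_sym => nxk.
  have npk : p != k by rewrite eq_sym.
  have nqx : q != x by rewrite eq_sym.
  rewrite !v_neq // (f_neq sp sq pq) (f_neq s1 s2 n12) (f_neq sp sk npk) (f_neq sq sx nqx) nxk.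
  by rewrite (f_neq s1 sx n1) (f_neq s1 sk m1) (f_neq s2 sx n2) (f_neq s2 sk m2)
    (g_neq sp sx px) (g_neq sq sk qk) !(adj_neq e_irr).
have qk' : e (f q) (f k) by rewrite -gE.
have kx' : e (f k) (f x) by rewrite -gE.
have px' : e (f p) (f x) by rewrite -gE.
have := no_K33_path pl un; rewrite /= !vf // p1 p2 q1 q2 px' kx' qk'.
by move/(_ isT isT isT isT).
Qed.

Lemma apex_planar : ~~ apex_nonplanar g (iota 0 m).
Proof.
by rewrite /apex_nonplanar (negbTE K4_in_nbh) (negbTE K23_in_nbh) (negbTE K23_path_in_nbh).
Qed.
End Vertex.

(** The sum counts twice each of the at most nine edges inside the neighbourhood. *)
Lemma nbh6_inner_degrees v : deg e v = 6 -> \sum_(x in nbh e v) #|nbh e x :&: nbh e v| <= 18.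
Proof.
move=> dv; pose s := enum (nbh e v); pose f := nth v s.
have us : uniq s := enum_uniq _.
have sz : size s = 6 by rewrite -dv /deg cardE.
have sE : nbh e v =i s by move=> x; rewrite mem_enum.
have f_inj : {in iota 0 6 &, injective f}.
  by move=> i j; rewrite !mem_iota -sz => hi hj /eqP; rewrite nth_uniq // => /eqP.
have vf : {in iota 0 6, forall i, e v (f i)}.
  by move=> i; rewrite mem_iota -sz => hi; rewrite -in_nbh sE mem_nth.
have gE : {in iota 0 6 &, forall i j,
    adj_of_bits (bits_of_adj e f 6) i j = e (f i) (f j)}.
  by move=> i j; rewrite !mem_iota => hi hj; rewrite adj_of_bitsE.
have := all_bitseqsP six_vertices_check (l := bits_of_adj e f 6) (erefl _).
case: ifP => [_|/negbT]; first by rewrite (negbTE (apex_planar f_inj vf gE)).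
rewrite -leqNgt => le9 _.
have -> : \sum_(x in nbh e v) #|nbh e x :&: nbh e v| =
    \sum_(x <- s) \sum_(y <- s) e x y.
  rewrite (eq_bigl (mem s)) => [|x]; last by rewrite sE.
  rewrite -big_uniq //; apply: eq_bigr => x _; rewrite (card_setI_count _ us sE) -sum1_count.
  by rewrite big_mkcond; apply: eq_bigr => y _; rewrite /= inE; case: (e x y).
move: le9; rewrite /bits_of_adj /= /f.
case: s sz {us sE f_inj vf gE f} => [|v0 [|v1 [|v2 [|v3 [|v4 [|v5 [|? ?]]]]]]] // _ /=.
rewrite !big_cons !big_nil !e_irr (e_sym v1 v0) (e_sym v2 v0) (e_sym v2 v1).
rewrite (e_sym v3 v0) (e_sym v3 v1) (e_sym v3 v2) (e_sym v4 v0) (e_sym v4 v1) (e_sym v4 v2).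
rewrite (e_sym v4 v3) (e_sym v5 v0) (e_sym v5 v1) (e_sym v5 v2) (e_sym v5 v3) (e_sym v5 v4).
do 15!move: (nat_of_bool (e _ _)) => ?.
lia.
Qed.

(** The list [s] need not exhaust the neighbourhood: the lemma also serves for five of the six
    neighbours of a vertex of degree 6. *)
Lemma nbh5_fan v v0 v1 v2 v3 v4 : let s := [:: v0; v1; v2; v3; v4] in
  uniq s -> all (e v) s -> all (fun x => 2 < count (e x) s) [:: v0; v1; v2] ->
  all (fun x => 1 < count (e x) s) [:: v3; v4] ->
  exists h b c a d, [/\ perm_eq [:: h; b; c] [:: v0; v1; v2],
    perm_eq [:: a; d] [:: v3; v4] & fan e h b c a d].
Proof.
move=> s us vs d012 d34; pose f := nth v s.
have f_inj : {in iota 0 5 &, injective f}.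
  by move=> i j; rewrite !mem_iota => hi hj /eqP; rewrite nth_uniq // => /eqP.
have vf : {in iota 0 5, forall i, e v (f i)}.
  by move=> i; rewrite mem_iota => hi; apply: (allP vs); rewrite mem_nth.
pose g := adj_of_bits (bits_of_adj e f 5).
have gE : {in iota 0 5 &, forall i j, g i j = e (f i) (f j)}.
  by move=> i j; rewrite !mem_iota => hi hj; rewrite /g adj_of_bitsE.
have degE i : i < 5 -> in_deg g 5 i = count (e (f i)) s.
  move=> i5; rewrite /in_deg; have -> : s = map f (iota 0 5) by [].
  by rewrite count_map; apply: eq_in_count => j sj; rewrite gE // mem_iota.
have fanE i0 i1 i2 i3 i4 : all (fun i => i \in iota 0 5) [:: i0; i1; i2; i3; i4] ->
    fan g i0 i1 i2 i3 i4 = fan e (f i0) (f i1) (f i2) (f i3) (f i4).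
  by case/and5P=> s0 s1 s2 s3 /andP [s4 _]; rewrite /fan /= !gE.
have := all_bitseqsP five_vertices_check (l := bits_of_adj e f 5) (erefl _).
rewrite -/g /= !degE // (negbTE (apex_planar f_inj vf gE)) !fanE //.
move: d012 d34; rewrite /= -!/s => -> /andP [-> /andP [-> _]] /=.
have p01 : perm_eq [:: v1; v0; v2] [:: v0; v1; v2] by rewrite (perm_catCA [:: v1] [:: v0]).
have p02 : perm_eq [:: v2; v0; v1] [:: v0; v1; v2] by rewrite (perm_catC [:: v2]).
have p34 : perm_eq [:: v4; v3] [:: v3; v4] by rewrite (perm_catC [:: v4]).
case/or4P => [h|h|h|/or3P [h|h|h]].
- by exists v0, v1, v2, v3, v4.
- by exists v0, v1, v2, v4, v3.
- by exists v1, v0, v2, v3, v4.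
- by exists v1, v0, v2, v4, v3.
- by exists v2, v0, v1, v3, v4.
- by exists v2, v0, v1, v4, v3.
Qed.
End Apex.

(** * Discharging *)

Lemma eq_mem_card (T : finType) (A : {set T}) (s : seq T) : uniq s ->
  {subset s <= A} -> #|A| <= size s -> A =i s.
Proof.
move=> us sA leA x; have sub : [set y in s] \subset A by apply/subsetP => y; rewrite inE => /sA.
have /eqP <- : [set y in s] == A by rewrite eqEcard sub cardsE (card_uniqP us).
by rewrite inE.
Qed.

Lemma fan_end_count (T : eqType) (e : rel T) (h b c a d : T) (s : seq T) :
  symmetric e -> irreflexive e -> fan e h b c a d -> perm_eq [:: h; b; c; a; d] s ->
  count (e a) s = 2 /\ count (e d) s = 2.
Proof.
move=> e_sym e_irr; rewrite /fan /= !andbT => /andP [/and4P [ha hb hc hd]].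
case/and5P=> ab bc cd ac /andP [ad bd] /permP perm.
rewrite -!perm.
rewrite /= !e_irr (e_sym a h) (e_sym d h) (e_sym d b) (e_sym d c) (e_sym d a).
by rewrite ha hd ab cd (negbTE ac) (negbTE ad) (negbTE bd).
Qed.

Lemma card_setD_gt (T : finType) (A B : {set T}) (m k : nat) :
  #|B| <= m -> k + m < #|A| -> k < #|A :\: B|.
Proof.
by have := cardsD A B; have := subset_leq_card (subsetIr A B); lia.
Qed.

Lemma cards3 (T : finType) (x y z : T) : #|[set x; y; z]| <= 3.
Proof. by rewrite setUC cardsU1 cards2; case: (_ \notin _); case: (_ != _). Qed.

Lemma leq_card_split (T : finType) (A B : {set T}) (k m : nat) :
  #|A :\: B| <= k -> #|A :&: B| <= m -> #|A| <= m + k.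
Proof. by rewrite -(cardsID B A) => ? ?; apply: leq_add. Qed.

Lemma fan_rev (T : eqType) (e : rel T) (h b c a d : T) : symmetric e ->
  fan e h b c a d -> fan e h c b d a.
Proof.
move=> e_sym; rewrite /fan /= !andbT => /andP [/and4P [-> -> -> ->]].
by case/and5P=> ab bc cd ac /andP [ad bd]; rewrite !(e_sym d) (e_sym c b) (e_sym c a)
  (e_sym b a) cd bc ab bd ad ac.
Qed.

(** * Neighbours of vertices of degree 4, 5 and 6, and the transfer of charge *)

Section Local.
Variables (T : finType) (e : rel T).
Hypotheses (e_sym : symmetric e) (e_irr : irreflexive e) (pl : planar e).
Hypothesis free : ~ contains_subgraph e (double_star 2 4).

Local Notation nbh := (nbh e).
Local Notation deg := (deg e).
Local Notation cnbh := (cnbh e).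

Let deg5 x y : deg y = 5 -> e y x -> #|nbh x :\: cnbh y| <= 1.
Proof. by move=> dy yx; apply: deg5_nbr; rewrite // e_sym. Qed.

Let deg6 x y : deg y = 6 -> e y x -> 2 < deg x -> nbh x \subset cnbh y.
Proof. by move=> dy yx; apply: deg6_nbr; rewrite // e_sym. Qed.

Lemma card_nbhI_cnbh x y : e x y -> #|nbh x :&: cnbh y| = (#|nbh x :&: nbh y|).+1.
Proof.
move=> xy; rewrite /cnbh setIUr cardsU (_ : nbh x :&: [set y] = [set y]).
  rewrite cards1 (_ : [set y] :&: _ = set0) ?cards0 ?subn0 //.
  by apply/setP => u; rewrite !inE; case: eqP => // ->; rewrite e_irr andbF.
by apply/setP => u; rewrite !inE andbC; case: eqP => // ->.
Qed.

(** The 2 accounts for [y] itself and for at most one neighbour of [x] outside [N[y]]. *)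
Lemma deg5_inner_deg x y : deg y = 5 -> e y x -> deg x <= #|nbh x :&: nbh y| + 2.
Proof.
move=> dy yx; have := deg5 dy yx; have := cardsID (cnbh y) (nbh x).
by rewrite card_nbhI_cnbh ?(e_sym x) // -/(deg x); lia.
Qed.

Lemma deg6_inner_deg x y : deg y = 6 -> e y x -> 2 < deg x -> deg x = (#|nbh x :&: nbh y|).+1.
Proof.
move=> dy yx dx; have /setIidPl h := deg6 dy yx dx.
by rewrite -card_nbhI_cnbh ?(e_sym x) // h.
Qed.

Lemma deg5_missed_uniq x y p q : deg y = 5 -> e y x -> e x p -> p != y -> ~~ e y p ->
  e x q -> q != p -> (q == y) || e y q.
Proof.
move=> dy yx xp py nyp xq qp; apply: contraT; rewrite negb_or => /andP [qy nyq].
have := deg5 dy yx; rewrite leqNgt => /negP; case; apply/card_gt1P.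
by exists p, q; rewrite !inE !negb_or xp xq py qy nyp nyq eq_sym.
Qed.

(** Four neighbours of degree 5 would be pairwise adjacent, forming a [K_5] with [z]; two
    nonadjacent ones would lead to a [K_{3,3}]. *)
Lemma deg4_deg5_nbrs z : deg z = 4 -> #|[set u in nbh z | deg u == 5]| <= 3.
Proof.
move=> dz; rewrite leqNgt; apply/negP => c4.
have all5 u : e z u -> deg u = 5.
  have sub : [set u in nbh z | deg u == 5] \subset nbh z by apply/subsetP => w;
    rewrite inE => /andP [].
  have /eqP E : [set u in nbh z | deg u == 5] == nbh z by rewrite eqEcard sub -/(deg z) dz.
  by rewrite -in_nbh -E !inE => /andP [_ /eqP].
have adj a b : e z a -> e z b -> a != b -> e a b.
  move=> za zb ab; apply: contraT => nab.
  have : 0 < #|nbh z :\: [set a; b]|.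
    by apply: (@card_setD_gt _ _ _ 2); rewrite ?cards2 ?ab -/(deg z) ?dz.
  case/card_gt0P => c; rewrite !inE negb_or => /andP [/andP [ca cb] zc].
  have az : e a z by rewrite e_sym.
  have bz : e b z by rewrite e_sym.
  (* [z] already has its neighbour [b] outside [N[a]], so [c] is in [N[a]]; likewise for [b]. *)
  have ac : e a c.
    have := deg5_missed_uniq (all5 _ za) az zb _ nab zc cb.
    by rewrite eq_sym (negbTE ca) /=; apply.
  have nba : ~~ e b a by rewrite e_sym.
  have bc : e b c.
    have := deg5_missed_uniq (all5 _ zb) bz za ab nba zc ca.
    by rewrite (negbTE cb).
  (* [c] has the neighbour [b] outside [N[a]] and the neighbour [a] outside [N[b]], so its others
     lie in both. Two of them, [u] and [w], form with [z] one side of a [K_{3,3}] whose other side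
     is [a], [b], [c]. *)
  have common w : e c w -> w != z -> w != a -> w != b -> e a w && e b w.
    move=> cw wz wa wb; apply/andP; split.
      have cb' : e c b by rewrite e_sym.
      have := deg5_missed_uniq (all5 _ za) ac cb' _ nab cw wb.
      by rewrite (negbTE wa) /= eq_sym; apply.
    have ca' : e c a by rewrite e_sym.
    have := deg5_missed_uniq (all5 _ zb) bc ca' ab nba cw wa.
    by rewrite (negbTE wb).
  have : 1 < #|nbh c :\: [set z; a; b]|.
    by apply: (card_setD_gt (cards3 z a b)); rewrite -/(deg c) (all5 _ zc).
  case/card_gt1P => u [w []]; rewrite !inE !negb_or -!andbA.
  move=> /and4P [uz ua ub cu] /and4P [wz wa wb cw] uw.
  have /andP [au bu] := common u cu uz ua ub; have /andP [aw bw] := common w cw wz wa wb.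
  have ne x y : e x y -> x != y := @adj_neq _ _ e_irr x y.
  have un : uniq [:: z; u; w; a; c; b].
    rewrite /= !inE !negb_or uw ua ub wa wb ab !(eq_sym z) uz wz.
    have cb' : e c b by rewrite e_sym.
    by rewrite (eq_sym u c) (eq_sym w c) !(eq_sym _ z) !ne.
  have := no_K33 pl un; rewrite /allrel /= za zb zc !(e_sym u) !(e_sym w).
  by rewrite au bu cu aw bw cw.
have us : uniq (enum (nbh z)) := enum_uniq _.
have zs x : x \in enum (nbh z) -> e z x by rewrite mem_enum inE.
have sz : size (enum (nbh z)) = 4 by rewrite -dz /deg cardE.
move: us zs sz; case: (enum _) => [|a [|b [|c [|d [|? ?]]]]] // us zs _.
have un : uniq [:: z; a; b; c; d].
  by rewrite cons_uniq us andbT; apply/negP => /zs; rewrite e_irr.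
have := no_K5 pl un.
have [za zb zc zd] : [/\ e z a, e z b, e z c & e z d].
  by split; apply: zs; rewrite !inE eqxx ?orbT.
move: us; rewrite /= !inE !negb_or -!andbA => /and5P [ab ac ad bc /and3P [bd cd _]].
rewrite /= za zb zc zd (adj a b) // (adj a c) // (adj a d) // (adj b c) //.
by rewrite (adj b d) // (adj c d).
Qed.

(* The vertices of degree 5 that have no neighbour of degree at most 3 to absorb
   their excess degree. *)
Definition needy u := (deg u == 5) && [forall z, e u z ==> (3 < deg z)].

Definition needy_nbrs z := [set u in nbh z | needy u].

Lemma needyP u : reflect (deg u = 5 /\ forall z, e u z -> 3 < deg z) (needy u).
Proof.
apply: (iffP andP) => [[/eqP du /forallP h]|[du h]]; split=> //.
- by move=> z; apply/implyP.
- exact/eqP.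
- by apply/forallP => z; apply/implyP/h.
Qed.

(* [b] is not needy: planarity and the degree-5 condition force its neighbour outside
   [N[y]] to have degree at most 3. *)
Lemma fan_needy_nbrs y h b c a d : deg y = 5 -> deg h = 5 -> deg b = 5 ->
  uniq [:: h; b; c; a; d] -> all (e y) [:: h; b; c; a; d] -> fan e h b c a d ->
  #|needy_nbrs a| <= 2.
Proof.
move=> dy dh db un ay fn.
have yE : nbh y =i [:: h; b; c; a; d].
  by apply: eq_mem_card; rewrite // -/(deg y) ?dy // => x /(allP ay); rewrite inE.
move: ay fn; rewrite /fan /= !andbT => /and5P [yh yb yc ya yd] /andP [/and4P [ha hb hc hd]].
case/and5P=> ab bc cd ac /andP [ad bd].
have ny u : u \in [:: h; b; c; a; d] -> u != y.
  by rewrite -yE inE => /(adj_neq e_irr); rewrite eq_sym.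
have hE : nbh h =i [:: y; b; c; a; d].
  apply: eq_mem_card; rewrite -/(deg h) ?dh //.
    move: un; rewrite !cons_uniq => /andP [_ ->]; rewrite andbT.
    by apply/negP => yin; have := ny y; rewrite eqxx inE yin orbT => /(_ isT).
  by apply/allP; rewrite /= !in_nbh hb hc ha hd e_sym yh.
have far u : u \notin [:: y; h; b; c; a; d] -> ~~ e y u && ~~ e h u.
  rewrite -(in_nbh e y) -(in_nbh e h) yE hE !inE !negb_or.
  by case/and5P=> -> -> -> -> /andP [-> ->].
have eay : e a y by rewrite e_sym.
have eah : e a h by rewrite e_sym.
have neqP u v w : e u v -> ~~ e u w -> w != v by move=> uv; apply: contraNneq => ->.
apply: leq_trans (_ : #|[set y; h]| <= 2); last by rewrite cards2; case: (_ != _).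
apply/subset_leq_card/subsetP => u; rewrite !inE => /andP [au /needyP [du hu]].
apply: contraT; rewrite negb_or => /andP [uy uh]; exfalso.
(* A needy neighbour [u] of [a] other than [y], [h], [b] is adjacent to neither [y] nor [h], so [a]
   would have two neighbours outside [N[u]]. *)
have [ub|ub] := eqVneq u b; last first.
  have ua : u != a by rewrite eq_sym (adj_neq e_irr).
  have uc : u != c by rewrite eq_sym (neqP a).
  have ud : u != d by rewrite eq_sym (neqP a).
  have /far /andP [nyu nhu] : u \notin [:: y; h; b; c; a; d].
    by rewrite !inE !negb_or uy uh ub uc ua ud.
  have ua' : e u a by rewrite e_sym.
  have := deg5 du ua'; rewrite leqNgt => /negP; case; apply/card_gt1P; exists y, h.
  rewrite !inE !negb_or eay eah !(eq_sym _ u) uy uh !(e_sym u) nyu nhu.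
  by split=> //; rewrite (adj_neq e_irr).
(* [w] is the fifth neighbour of [b], besides [y], [h], [a] and [c]. *)
subst u; have /card_gt0P [w] : 0 < #|nbh b :\: ([set y; h; a] :|: [set c])|.
  apply: (@card_setD_gt _ _ _ 4); last by rewrite -/(deg b) db.
  by rewrite (leq_trans (leq_card_setU _ _)) // cards1 addn1 ltnS cards3.
rewrite !inE !negb_or -!andbA => /and5P [wy wh wa wc bw].
have wb : w != b by rewrite eq_sym (adj_neq e_irr).
have wd : w != d by rewrite eq_sym (neqP b).
have /far /andP [nyw nhw] : w \notin [:: y; h; b; c; a; d].
  by rewrite !inE !negb_or wy wh wb wc wa wd.
(* [w] has at most one neighbour outside [N[b]]; with only two inside, its degree would be at most
   3, although [b] is assumed needy. So [w] is adjacent to both [a] and [c], and [y], [h], [w]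
   against [a], [b], [c] form a [K_{3,3}]. *)
have key p : {subset nbh w :&: cnbh b <= [set b; p]} -> False.
  move=> sub; have := hu w bw; rewrite ltnNge => /negP; case.
  apply: (leq_card_split (m := 2) (deg5 db bw)).
  by rewrite (leq_trans (subset_leq_card (introT subsetP sub))) // cards2; case: (_ != _).
have nac : a != c.
  by move: un; rewrite /= !inE !negb_or => /and5P [_ _ /andP [ca _] _ _]; rewrite eq_sym ca.
have bE : nbh b =i [:: y; h; a; c; w].
  apply: eq_mem_card; rewrite -/(deg b) ?db //; last first.
    by apply/allP; rewrite /= !in_nbh bc bw !(e_sym b) yb hb ab.
  by rewrite /= !inE !negb_or !(eq_sym _ w) wy wh wa wc nac !(adj_neq e_irr).
have sub x : x \in nbh w :&: cnbh b -> x \in [:: b; a; c].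
  rewrite !inE -(in_nbh e b) bE !inE => /andP [wx /orP [->//|/or4P [] ]].
  - by move/eqP=> xy; rewrite e_sym -xy wx in nyw.
  - by move/eqP=> xy; rewrite e_sym -xy wx in nhw.
  - by move->; rewrite orbT.
  - case/orP => [->|/eqP xw]; first by rewrite !orbT.
    by rewrite xw e_irr in wx.
have ewa : e w a.
  apply: contraT => nwa; case: (key c) => x sx; have := sub x sx; rewrite !inE.
  case/or3P=> [->|/eqP xa|->]; rewrite ?orbT //.
  by move: sx; rewrite !inE xa (negbTE nwa).
have ewc : e w c.
  apply: contraT => nwc; case: (key a) => x sx; have := sub x sx; rewrite !inE.
  case/or3P=> [->|->|/eqP xc]; rewrite ?orbT //.
  by move: sx; rewrite !inE xc (negbTE nwc).
have ewb : e w b by rewrite e_sym.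
have unK : uniq [:: y; h; w; a; b; c].
  by rewrite /= !inE !negb_or !(eq_sym _ w) wy wh wa wb wc nac !(adj_neq e_irr).
by have := no_K33 pl unK; rewrite /allrel /= ya yb yc ha hb hc ewa ewb ewc.
Qed.

Lemma deg4_share y z : needy y -> e y z -> deg z = 4 -> 2 <= 6 %/ #|needy_nbrs z|.
Proof.
move=> ny yz dz; have : 0 < #|needy_nbrs z|.
  by apply/card_gt0P; exists y; rewrite !inE e_sym yz.
have : #|needy_nbrs z| <= 3.
  apply: leq_trans (deg4_deg5_nbrs dz); apply/subset_leq_card/subsetP => u.
  by rewrite !inE => /andP [-> /andP []].
by case: #|_| => [|[|[|[|k]]]].
Qed.

Lemma count_nbh x y s : uniq s -> nbh y =i s -> count (e x) s = #|nbh x :&: nbh y|.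
Proof.
by move=> us sE; rewrite (card_setI_count _ us sE); apply: eq_count => z; rewrite /= inE.
Qed.

(** Three neighbours of degree 4 take at least 2 each. Otherwise three neighbours have degree 5, and
    the inner degrees force a fan; its ends have inner degree 2, hence degree 4, and each has at
    most two needy neighbours, so takes at least 3. *)
Lemma needy_shares y : needy y -> (forall z, e y z -> deg z <= 5) ->
  6 <= \sum_(z in [set z in nbh y | deg z == 4]) 6 %/ #|needy_nbrs z|.
Proof.
move=> ny le5; have [dy ge4] := needyP _ ny; set D := [set z in _ | _].
have DP z : z \in D -> e y z /\ deg z = 4 by rewrite !inE => /andP [-> /eqP].
have [D3|D3] := leqP 3 #|D|.
  apply: (@leq_trans (\sum_(z in D) 2)).
    by rewrite sum_nat_const (@leq_mul 3 2).
  by apply: leq_sum => z /DP [yz dz]; apply: (deg4_share ny).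
have DS : D \subset nbh y by apply/subsetP => z /DP []; rewrite inE.
have sz1 : 2 < #|nbh y :\: D|.
  by rewrite cardsDS // -/(deg y) dy ltn_subRL; move: D3; clear; case: #|D| => [|[|[|]]].
(* The neighbours of degree 5 come first, so that the first three entries have degree 5. *)
pose s := enum (nbh y :\: D) ++ enum D.
have us : uniq s.
  rewrite cat_uniq !enum_uniq andbT /=; apply/hasPn => z.
  by rewrite !mem_enum in_setD => ->.
have sE : nbh y =i s.
  move=> z; rewrite mem_cat !mem_enum in_setD.
  by have /subsetP /(_ z) := DS; case: (z \in D); case: (z \in nbh y) => // /(_ isT).
have szs : size s = 5.
  by rewrite -dy /deg (eq_card sE) (card_uniqP us).
have first3 i : i < 3 -> deg (nth y s i) = 5.
  move=> i3; have i1 : i < size (enum (nbh y :\: D)) by rewrite -cardE (leq_trans i3).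
  have : nth y s i \in nbh y :\: D by rewrite nth_cat i1 -mem_enum mem_nth.
  rewrite !inE => /andP [nD yi]; have := le5 _ yi; have := ge4 _ yi.
  by move: nD; rewrite yi /=; case: (deg _) => [|[|[|[|[|[|]]]]]].
have inner x : x \in s -> deg x <= count (e x) s + 2.
  by rewrite -sE (count_nbh _ us sE) inE; apply: deg5_inner_deg.
clearbody s; case: s szs us sE first3 inner => [|v0 [|v1 [|v2 [|v3 [|v4 [|? ?]]]]]] // _.
set s := [:: v0; v1; v2; v3; v4] => us sE first3 inner.
have ys : all (e y) s by apply/allP => x; rewrite -sE inE.
have in3 x : x \in [:: v0; v1; v2] -> deg x = 5 /\ x \in s.
  by rewrite !inE => /or3P [] /eqP ->; split; rewrite ?eqxx ?orbT //;
    [apply: (first3 0)|apply: (first3 1)|apply: (first3 2)].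
have in2 x : x \in [:: v3; v4] -> x \in s.
  by rewrite !inE => /orP [] ->; rewrite ?orbT.
have [||h [b [c [a [d [p3 p2 fn]]]]]] := nbh5_fan e_sym e_irr pl us ys.
- by apply/allP => x /in3 [dx /inner]; rewrite dx addn2 !ltnS.
- apply/allP => x /in2 xs; have := inner x xs; have /allP/(_ x xs)/ge4 := ys.
  by rewrite -/s addn2; case: (deg x) => [|[|[|[|k]]]] // _; rewrite !ltnS; apply: leq_trans.
have perm : perm_eq [:: h; b; c; a; d] s.
  by rewrite -[_ :: _]/([:: h; b; c] ++ [:: a; d]) -[s]/([:: v0; v1; v2] ++ [:: v3;
    v4]) perm_cat.
have un : uniq [:: h; b; c; a; d] by rewrite (perm_uniq perm).
have yall : all (e y) [:: h; b; c; a; d] by rewrite (perm_all _ perm).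
have [ca cd] := fan_end_count e_sym e_irr fn perm.
have [[dh _] [db _] [dc _]] : [/\ deg h = 5 /\ h \in s, deg b = 5 /\ b \in s
  & deg c = 5 /\ c \in s].
  by split; apply: in3; rewrite -(perm_mem p3) !inE eqxx ?orbT.
have inD x : x \in [:: a; d] -> count (e x) s = 2 -> x \in D.
  rewrite (perm_mem p2) => /in2 xs cx; have yx : e y x := allP ys x xs.
  rewrite !inE yx /= eqn_leq ge4 // andbT.
  by have := inner x xs; rewrite cx.
have aD : a \in D by apply: inD; rewrite ?inE ?eqxx.
have dD : d \in D by apply: inD; rewrite ?inE ?eqxx ?orbT.
have ta := fan_needy_nbrs dy dh db un yall fn.
have un' : perm_eq [:: h; c; b; d; a] [:: h; b; c; a; d].
  rewrite perm_cons -[_ :: _]/([:: c; b] ++ [:: d; a]) -[X in perm_eq _ X]/([:: b; c] ++ [:: a;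
    d]).
  by rewrite perm_cat // ?(perm_catC [:: c]) ?(perm_catC [:: d]).
have td : #|needy_nbrs d| <= 2.
  apply: (fan_needy_nbrs dy dh dc _ _ (fan_rev e_sym fn)).
    by rewrite (perm_uniq un').
  by rewrite (perm_all _ un').
have share3 x : x \in D -> #|needy_nbrs x| <= 2 -> 3 <= 6 %/ #|needy_nbrs x|.
  move=> /DP [yx dx]; have : 0 < #|needy_nbrs x|.
    by apply/card_gt0P; exists y; rewrite !inE e_sym yx.
  by case: #|_| => [|[|[|k]]].
have da : d != a by move: un; rewrite /= !inE !negb_or => /and5P [_ _ _ ad _]; rewrite eq_sym.
rewrite (bigD1 a) //= (bigD1 d) ?dD //= addnA.
by apply: leq_trans (leq_addr _ _); apply: (@leq_add 3 3); apply: share3.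
Qed.
(** Otherwise the five other neighbours of [y] have degree at least 4, hence at least three
    neighbours each inside [N(y)]. As [x] is adjacent to at most one of them, four keep three
    neighbours among the five and the last keeps two. This forces a fan with both ends of inner
    degree 2, too many. *)
Lemma deg6_one_small_nbr y x : deg y = 6 -> e y x -> deg x <= 2 ->
  exists z, [/\ e y z, z != x & deg z <= 3].
Proof.
move=> dy yx dx; suff /existsP [z /and3P [yz zx dz]] :
    [exists z, [&& e y z, z != x & deg z <= 3]] by exists z.
apply: contraT => /existsPn no.
have ge4 z : e y z -> z != x -> 3 < deg z.
  by move=> yz zx; rewrite ltnNge; apply: contra (no z) => dz; apply/and3P.
exfalso; pose B := nbh y :\ x.
have BE z : (z \in B) = (z != x) && e y z by rewrite !inE.
have cB : #|B| = 5 by have := cardsD1 x (nbh y); rewrite -/(deg y) dy inE yx => -[].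
have B1 : #|B :&: nbh x| <= 1.
  have h := cardsD1 y (nbh x); rewrite inE e_sym yx add1n in h.
  rewrite -ltnS (leq_trans _ dx) // /deg h ltnS.
  apply/subset_leq_card/subsetP => z; rewrite !inE => /andP [/andP [_ yz] ->].
  by rewrite eq_sym (adj_neq e_irr).
clearbody B; pose s := enum (B :\: nbh x) ++ enum (B :&: nbh x).
have us : uniq s.
  rewrite cat_uniq !enum_uniq andbT /=; apply/hasPn => z.
  by rewrite !mem_enum in_setD in_setI => /andP [_ ->].
have sE : B =i s.
  by move=> z; rewrite mem_cat !mem_enum in_setD in_setI; case: (z \in nbh x); case: (z \in B).
have szs : size s = 5 by rewrite -cB (eq_card sE) (card_uniqP us).
have sz1 : 3 < #|B :\: nbh x|.
  move: B1; have := cardsID (nbh x) B; rewrite cB.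
  move: #|B :&: _| #|B :\: _| => p q; clear; lia.
have first4 i : i < 4 -> ~~ e x (nth y s i).
  move=> i4; have i1 : i < size (enum (B :\: nbh x)) by rewrite -cardE (leq_trans i4).
  have : nth y s i \in B :\: nbh x by rewrite nth_cat i1 -mem_enum mem_nth.
  by rewrite in_setD inE => /andP [].
have inner z : z \in s -> 3 <= count (e z) s + e x z.
  rewrite -sE BE => /andP [zx yz].
  have -> : count (e z) s = #|nbh z :&: B|.
    by rewrite (card_setI_count _ us sE); apply: eq_count => w; rewrite /= inE.
  have dz := ge4 z yz zx; have dzE := deg6_inner_deg dy yz (ltnW dz).
  rewrite dzE ltnS in dz; apply: leq_trans dz _.
  rewrite (cardsD1 x) !inE yx andbT (e_sym x) addnC leq_add2r.
  by apply/subset_leq_card/subsetP => w; rewrite !inE BE => /and3P [-> -> ->].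
clearbody s; case: s szs us sE first4 inner => [|v0 [|v1 [|v2 [|v3 [|v4 [|? ?]]]]]] // _.
set s := [:: v0; v1; v2; v3; v4] => us sE first4 inner.
have ys : all (e y) s by apply/allP => z; rewrite -sE BE => /andP [].
have in4 z : z \in [:: v0; v1; v2; v3] -> 2 < count (e z) s.
  move=> zs; have zs' : z \in s.
    by move: zs; rewrite !inE => /or4P [] ->; rewrite ?orbT.
  have := inner z zs'; suff /negbTE -> : ~~ e x z by rewrite addn0.
  move: zs; rewrite !inE => /or4P [] /eqP ->;
    [apply: (first4 0)|apply: (first4 1)|apply: (first4 2)|apply: (first4 3)] => //.
have [||h [b [c [a [d [p3 p2 fn]]]]]] := nbh5_fan e_sym e_irr pl us ys.
- by apply/allP => w ws; apply: in4; move: ws; rewrite !inE => /or3P [] ->; rewrite ?orbT.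
- apply/allP => w; rewrite !inE => /orP [] /eqP ->.
    by rewrite ltnW // in4 // !inE eqxx ?orbT.
  have : v4 \in s by rewrite !inE eqxx !orbT.
  by move/inner; rewrite -/s; case: (e x v4); rewrite ?addn1 ?addn0 // => /ltnW.
have perm : perm_eq [:: h; b; c; a; d] s.
  by rewrite -[_ :: _]/([:: h; b; c] ++ [:: a; d]) -[s]/([:: v0; v1; v2] ++ [:: v3;
    v4]) perm_cat.
have [ca cd] := fan_end_count e_sym e_irr fn perm.
(* [v3] is one of the four with inner degree at least 3, yet an end of the fan. *)
have v3s : 2 < count (e v3) s by rewrite in4 // !inE eqxx !orbT.
have : v3 \in [:: a; d] by rewrite (perm_mem p2) inE eqxx.
by rewrite !inE => /orP [] /eqP E; move: v3s; rewrite E ?ca ?cd.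
Qed.

(** [N[h]] has seven vertices and contains the six of [N[v]]. Two neighbours of [h] of degree at
    most 3 would both lie outside [N[v]], because [v] is needy. *)
Lemma needy_nbr_deg6 v h x : needy v -> e v h -> deg h = 6 -> e h x -> 2 < deg x.
Proof.
move=> nv vh dh hx; rewrite ltnNge; apply/negP => dx.
have [dv ge4] := needyP _ nv; have hv : e h v by rewrite e_sym.
have sub : nbh v \subset cnbh h by apply: deg6 => //; rewrite dv.
have [z [hz zx dz]] := deg6_one_small_nbr dh hx dx.
have nvx w : deg w <= 3 -> (w != v) && ~~ e v w.
  move=> dw; apply/andP; split; first by apply: contraTneq dw => ->; rewrite dv.
  by apply: contraL dw => /ge4; rewrite ltnNge.
have /andP [xv nvX] := nvx x (leqW dx); have /andP [zv nvz] := nvx z dz.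
have : #|v |: (x |: (z |: nbh v))| <= #|cnbh h|.
  apply/subset_leq_card/subsetP => w; rewrite !inE => /or4P [/eqP ->|/eqP ->|/eqP ->|vw].
  - by rewrite hv orbT.
  - by rewrite hx orbT.
  - by rewrite hz orbT.
  - by have /subsetP/(_ w) := sub; rewrite !inE; apply.
rewrite !cardsU1 !inE !negb_or -/(deg v) -/(deg h) dv dh !e_irr (negbTE nvX) (negbTE nvz).
by rewrite !(eq_sym v) xv zv eq_sym zx.
Qed.

Lemma needy_nbr_le5 v u : needy v -> (forall h, e v h -> deg h = 6 -> exists2 x, e h x
  & deg x <= 2) ->
  e v u -> deg u <= 5.
Proof.
move=> nv ex6 vu; have [dv _] := needyP _ nv; rewrite leqNgt; apply/negP => du.
have [du6|ne] := eqVneq (deg u) 6.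
  by have [x ux dx] := ex6 u vu du6; have := needy_nbr_deg6 nv vu du6 ux; rewrite ltnNge dx.
have /(deg7_nbr e_sym e_irr free)/(_ vu) : 6 < deg u by rewrite ltn_neqAle eq_sym ne.
by rewrite dv.
Qed.

(* How much of [12 * deg u - 54] is moved from [u] to its neighbour [v], which can
   absorb it if [12 * deg v < 54]. *)
Definition transfer u v : nat :=
  if deg u <= 4 then 0 else
  if deg v <= 2 then 15 else if deg v == 3 then 6 else
  if (deg v == 4) && needy u then 6 %/ #|needy_nbrs v| else 0.

Lemma transfer_sub (A : {set T}) v c : A \subset nbh v ->
  (forall u, u \in A -> c <= transfer v u) ->
  #|A| * c <= \sum_(u in nbh v) transfer v u.
Proof.
move=> sub le; rewrite (big_setID A) /= (setIidPr sub).
apply: leq_trans (leq_addr _ _); rewrite -sum_nat_const.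
by apply: leq_sum => u /le.
Qed.

Lemma discharging v :
  (deg v = 6 -> exists2 x, e v x & deg x <= 2) ->
  (forall h, e v h -> deg h = 6 -> exists2 x, e h x & deg x <= 2) ->
  12 * deg v + \sum_(u in nbh v) transfer u v <= 54 + \sum_(u in nbh v) transfer v u.
Proof.
move=> v6 nbr6.
have le_in c : (forall u, transfer u v <= c) -> \sum_(u in nbh v) transfer u v <= deg v * c.
  by move=> le; rewrite -sum_nat_const; apply: leq_sum.
have [d4|d5] := leqP (deg v) 4.
  apply: leq_trans (leq_addr _ _).
  have [d2|d3] := leqP (deg v) 2.
    (* The amounts 15 and 6 are the most that can be absorbed: 2 * (12 + 15) = 54 and 3 * (12 + 6) =
       54. *)
    apply: (@leq_trans (12 * deg v + deg v * 15)); last by move: d2; clear; lia.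
    rewrite leq_add2l; apply: le_in => u.
    by rewrite /transfer d2; case: (deg u <= 4).
  have [e3|n3] := eqVneq (deg v) 3.
    apply: (@leq_trans (12 * deg v + deg v * 6)); last by rewrite e3.
    rewrite leq_add2l; apply: le_in => u.
    by rewrite /transfer e3; case: (deg u <= 4).
  have e4 : deg v = 4 by move: n3 d3 d4; case: (deg v) => [|[|[|[|[|k]]]]].
  (* A vertex of degree 4 has room for 6, shared equally among its needy neighbours. *)
  rewrite e4 -[54]/(12 * 4 + 6) leq_add2l.
  apply: (@leq_trans (\sum_(u in nbh v | needy u) 6 %/ #|needy_nbrs v|)).
    rewrite big_mkcondr /=; apply: leq_sum => u _.
    by rewrite /transfer e4 /=; case: (deg u <= 4); case: (needy u).
  rewrite (eq_bigl (mem (needy_nbrs v))) => [|u]; last by rewrite !inE.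
  by rewrite sum_nat_const mulnC leq_divM.
have -> : \sum_(u in nbh v) transfer u v = 0.
  apply: big1 => u _; rewrite /transfer; case: (deg u <= 4) => //.
  by move: d5; case: (deg v) => [|[|[|[|[|k]]]]].
rewrite addn0; have out u : e v u -> deg u <= 3 -> 6 <= transfer v u.
  by rewrite /transfer (leqNgt (deg v)) d5 /= => _; case: (deg u) => [|[|[|[|k]]]].
have out2 u : deg u <= 2 -> 15 <= transfer v u.
  by rewrite /transfer (leqNgt (deg v)) d5 /= => ->.
have [d5'|d6] := eqVneq (deg v) 5.
  rewrite d5' -[12 * 5]/(54 + 6) leq_add2l.
  have [/existsP [u /andP [vu du]]|] := boolP [exists u, e v u && (deg u <= 3)].
    have sub : [set u] \subset nbh v by rewrite sub1set inE.
    by have := transfer_sub (c := 6) sub; rewrite cards1; apply=> w; rewrite inE => /eqP ->;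
      exact: out.
  move=> /existsPn nex; have nv : needy v.
    apply/needyP; split=> // u vu; rewrite ltnNge; apply: contra (nex u) => du; exact/andP.
  have := needy_shares nv (fun u => needy_nbr_le5 nv nbr6).
  move/leq_trans; apply.
  rewrite [X in _ <= X](big_setID [set z in nbh v | deg z == 4]) /=.
  apply: leq_trans (leq_addr _ _).
  have -> : nbh v :&: [set z in nbh v | deg z == 4] = [set z in nbh v | deg z == 4].
    by apply/setIidPr/subsetP => z; rewrite inE => /andP [].
  apply: leq_sum => z; rewrite !inE => /andP [_ /eqP dz].
  by rewrite /transfer dz nv d5'.
have [d6'|d7] := eqVneq (deg v) 6.
  (* The excess 18 is covered by 15 to [x] and at least 6 to a second neighbour of degree at most
     3. *)
  rewrite d6' -[12 * 6]/(54 + 18) leq_add2l.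
  have [x vx dx] := v6 d6'; have [z [vz zx dz]] := deg6_one_small_nbr d6' vx dx.
  rewrite (bigD1 x) ?inE //= (bigD1 z) ?inE ?vz //= addnA.
  apply: leq_trans (leq_addr _ _); apply: (@leq_trans (15 + 6)) => //.
  by apply: leq_add; [apply: out2|apply: out].
(* Every neighbour now has degree at most 2 and takes 15, more than the 12 counted per edge. *)
have d7' : 6 < deg v by rewrite ltn_neqAle eq_sym d7 ltn_neqAle eq_sym d6.
have := @transfer_sub (nbh v) v 15 (subxx _).
rewrite -/(deg v) => h; apply: leq_trans (_ : deg v * 15 <= _); first by move: d7'; clear; lia.
apply: leq_trans (leq_addl _ _); apply: h => u; rewrite inE => vu; apply: out2.
by apply: (deg7_nbr e_sym e_irr free d7'); rewrite e_sym.
Qed.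

(** Each neighbour has its inner degree plus one for [y], so the total is at most 6 + 18 + 6. *)
Lemma deg_sum_cnbh y : deg y = 6 -> (forall x, e y x -> 2 < deg x) ->
  \sum_(v in cnbh y) deg v <= 30.
Proof.
move=> dy big; rewrite big_setU1 ?inE ?e_irr //= dy.
rewrite (eq_bigr (fun x => #|nbh x :&: nbh y| + 1)) => [|x]; last first.
  rewrite inE => yx; rewrite addn1.
  by apply: (deg6_inner_deg dy yx); exact: big.
rewrite big_split /= sum_nat_const -/(deg y) dy muln1.
by have := nbh6_inner_degrees e_sym e_irr pl dy; clear; lia.
Qed.

Lemma transfer_exchange (S : {set T}) : {in S, forall v, nbh v \subset S} ->
  \sum_(v in S) \sum_(u in nbh v) transfer u v = \sum_(v in S) \sum_(u in nbh v) transfer v u.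
Proof.
move=> clS; have restr (F : T -> T -> nat) : \sum_(v in S) \sum_(u in nbh v) F u v =
    \sum_(v in S) \sum_(u in S | e v u) F u v.
  apply: eq_bigr => v vS; apply: eq_bigl => u; rewrite inE.
  by have /subsetP/(_ u) := clS v vS; rewrite inE; case: (e v u);
    case: (u \in S) => // /(_ isT).
rewrite (restr transfer) (restr (fun u v => transfer v u)) (exchange_big_dep (mem S)) //=.
  by apply: eq_bigr => v vS; apply: eq_bigl => u; rewrite vS e_sym.
by move=> v u _ /andP [].
Qed.

(** Induction on [S], a union of components. A vertex of degree 6 without neighbours of degree at
    most 2 spans a component on seven vertices, which is removed: 12 * 30 <= 54 * 7. Once there is
    none, [discharging] is summed over [S] and the transfers cancel. *)
Lemma deg_sum_closed (S : {set T}) : {in S, forall v, nbh v \subset S} ->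
  12 * \sum_(v in S) deg v <= 54 * #|S|.
Proof.
have [n] := ubnP #|S|; elim: n S => // n IH S ltS clS.
have [/existsP [y /and3P [yS /eqP dy /forallP big]]|] :=
  boolP [exists y, [&& y \in S, deg y == 6 & [forall x, e y x ==> (2 < deg x)]]].
  have big' x : e y x -> 2 < deg x by apply/implyP/big.
  have CS : cnbh y \subset S.
    by apply/subsetP => x; rewrite !inE => /orP [/eqP -> //|yx]; apply: (subsetP (clS y yS));
      rewrite inE.
  have cC : #|cnbh y| = 7 by rewrite cardsU1 inE e_irr -/(deg y) dy.
  have clC u v : u \in cnbh y -> v \in nbh u -> v \in cnbh y.
    rewrite in_cnbh => /orP [/eqP ->|yu vu]; first by rewrite in_cnbh inE => ->; rewrite orbT.
    by apply: (subsetP (deg6 dy yu (big' u yu))).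
  have cS : #|S| = 7 + #|S :\: cnbh y| by rewrite cardsDS // cC subnKC // -cC subset_leq_card.
  rewrite (big_setID (cnbh y)) /= (setIidPr CS) cS.
  have : 12 * \sum_(v in S :\: cnbh y) deg v <= 54 * #|S :\: cnbh y|.
    apply: IH => [|v]; first by move: ltS; rewrite cS; clear; lia.
    rewrite in_setD => /andP [vC vS]; apply/subsetP => u vu; rewrite in_setD.
    rewrite (subsetP (clS v vS)) // andbT; apply: contra vC => uC.
    by apply: (clC u) => //; move: vu; rewrite !inE e_sym.
  have := deg_sum_cnbh dy big'.
  by move: (\sum_(v in cnbh y) deg v) (\sum_(v in S :\: cnbh y) deg v) #|_| => p q r; clear;
    lia.
move=> /existsPn no; have ex6 h : h \in S -> deg h = 6 -> exists2 x, e h x & deg x <= 2.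
  move=> hS dh; have := no h; rewrite hS dh eqxx /= => /forallPn [x].
  by rewrite negb_imply -leqNgt => /andP []; exists x.
have le : \sum_(v in S) (12 * deg v + \sum_(u in nbh v) transfer u v) <=
    \sum_(v in S) (54 + \sum_(u in nbh v) transfer v u).
  apply: leq_sum => v vS; apply: discharging; first exact: ex6.
  by move=> h vh; apply: ex6; apply: (subsetP (clS v vS)); rewrite inE.
move: le; rewrite [X in X <= _]big_split [X in _ <= X]big_split /= (transfer_exchange clS).
rewrite leq_add2r -big_distrr /=.
by rewrite sum_nat_const mulnC [X in _ <= X]mulnC.
Qed.
End Local.

(** * The handshake identity and the edge bound *)

Lemma sum_deg_nedges (n : nat) (e : rel 'I_n) : simple_graph e ->
  \sum_v deg e v = (nedges e).*2.
Proof.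
move=> [e_sym e_irr]; rewrite /nedges; set E := [set p | _].
pose E' := [set p : 'I_n * 'I_n | e p.1 p.2 && (p.2 < p.1)].
have -> : \sum_v deg e v = #|E| + #|E'|.
  transitivity #|[set p : 'I_n * 'I_n | e p.1 p.2]|.
    rewrite -sum1_card (eq_bigl (fun p : 'I_n * 'I_n => xpredT p.1 && e p.1 p.2)) => [|p].
      rewrite -(pair_big_dep xpredT (fun x y => e x y) (fun _ _ => 1)) /=.
      by apply: eq_bigr => v _; rewrite sum1_card; apply: eq_card => u; rewrite !inE.
    by rewrite !inE.
  rewrite -(cardsID [set p : 'I_n * 'I_n | p.1 < p.2]); congr (_ + _); apply: eq_card => p.
    by rewrite !inE.
  rewrite !inE -leqNgt andbC; case ep : (e p.1 p.2) => //=.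
  by rewrite leq_eqVlt; case: eqP => // /val_inj E12; rewrite E12 e_irr in ep.
have -> : #|E'| = #|E|.
  have swap_inj : injective (fun p : 'I_n * 'I_n => (p.2, p.1)) by move=> [? ?] [? ?] [-> ->].
  rewrite -(card_imset (mem E) swap_inj); apply: eq_card => p.
  apply/idP/imsetP => [|[q]]; last by rewrite !inE => h ->; rewrite e_sym.
  rewrite inE e_sym => h; exists (p.2, p.1); last by case: p h.
  by rewrite inE.
by rewrite addnn.
Qed.

(* ex_P(n, S_{2,4}) <= 17/7 n - 2, i.e. every planar S_{2,4}-free simple
   graph on n >= 12 vertices has e edges with 7 e <= 17 n - 14. *)
Theorem theorem1p1 (n : nat) (e : rel 'I_n) :
  (12 <= n)%N ->
  simple_graph e ->
  planar e ->
  ~ contains_subgraph e (double_star 2 4) ->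
  (7 * nedges e <= 17 * n - 14)%N.
Proof.
move=> n12 sg pl free; have [e_sym e_irr] := sg.
have := @deg_sum_closed _ e e_sym e_irr pl free setT.
rewrite cardsT card_ord (eq_bigl xpredT) ?sum_deg_nedges // => [|v]; last by rewrite inE.
(* With m edges, 24 m <= 54 n gives 7 m <= 63 n / 4, which is at most 17 n - 14 as soon as 5 n >=
   56; this is where [12 <= n] enters. *)
by move=> /(_ (fun v _ => subsetT _)); move: n12; clear; lia.
Qed.
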